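(* Let $d\ge 2$, let $A:\mathbb{S}^1\to\mathbb{S}^1$ be the Bowen-Series map of the Fuchsian group $G_d$, and let $\nu$ be the measure of maximal entropy of $A$. Let $\mu$ be the Patterson-Sullivan measure on $\partial X$ (with respect to the base point $1$ and the standard generating set), where $X$ is the Cayley tree of the free group $F_d\cong G_d$, and let $\psi:\partial X\to\mathbb{S}^1$ be the (Floyd-)Cannon-Thurston map. Then $\nu=\psi_\ast\mu$.
   Context: Let $\mathbb{D}$ be the unit disk, $\mathbb{S}^1=\partial\mathbb{D}$. For $1\le j\le d+1$ put $p_j=e^{\pi i(j-1)/d}$. For $1\le j\le d$ let $C_j$ be the hyperbolic geodesic of $\mathbb{D}$ joining $p_j$ and $p_{j+1}$, and let $g_j$ be the Möbius automorphism of $\mathbb{D}$ given by (anti-Möbius) reflection in $C_j$ followed by complex conjugation. Put $g_{-j}=g_j^{-1}$ and $G_d=\langle g_1,\dots,g_d\rangle$; this is a Fuchsian group, free on $g_1,\dots,g_d$, and $\mathbb{D}/G_d$ is a $(d+1)$-times punctured sphere. Let $I_j\subset\mathbb{S}^1$ be the closed counter-clockwise arc from $p_j$ to $p_{j+1}$ and $I_{-j}$ its complex conjugate. The Bowen-Series map $A:\mathbb{S}^1\to\mathbb{S}^1$ of $G_d$ is given by $A|_{I_{\pm j}}=g_{\pm j}$, $1\le j\le d$. It is a covering map topologically conjugate to $z\mapsto z^{2d-1}$ on $\mathbb{S}^1$; its measure of maximal entropy $\nu$ is the unique $A$-invariant Borel probability measure whose entropy equals the topological entropy $\ln(2d-1)$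 of $A$. Let $\Sigma_M^+$ be the one-sided subshift of sequences $(i_1,i_2,\dots)\in\{\pm1,\dots,\pm d\}^{\mathbb{N}}$ with $A(I_{i_k})\supset I_{i_{k+1}}$ (equivalently $i_{k+1}\ne -i_k$) for all $k$, with left shift $\sigma$. Let $X$ be the Cayley tree of $F_d\cong G_d$ for the standard generating set $\{g_{\pm1},\dots,g_{\pm d}\}$ with word length $|\cdot|$, and let $\partial X$ be its Gromov boundary, identified with $\Sigma_M^+$ by sending $(i_1,i_2,\dots)$ to the infinite reduced word $g_{i_1}^{-1}g_{i_2}^{-1}\cdots$. The (Floyd-)Cannon-Thurston map is $\psi:\partial X\cong\Sigma_M^+\to\mathbb{S}^1$, the continuous surjection with $\psi\circ\sigma=A\circ\psi$ mapping the set of sequences with $i_1=j$ onto $I_j$ for each $j\in\{\pm1,\dots,\pm d\}$. The Patterson-Sullivan measure on $\partial X$ (base point $1$, standard generating set) is the weak limit as $n\to\infty$, on the compact space $X\cup\partial X$, of the probability measures $\mu_n=\Big(\sum_{|g|\le n}(2d-1)^{-|g|}\delta_g\Big)\Big/\Big(\sum_{|g|\le n}(2d-1)^{-|g|}\Big)$. *)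

(* Defs.v *)
From HB Require Import structures.
From mathcomp Require Import all_boot all_order all_algebra.
From mathcomp Require Import complex.
From mathcomp Require Import all_classical all_reals all_analysis.
From mathcomp Require Import ring.
Set Implicit Arguments.
Unset Strict Implicit.
Unset Printing Implicit Defensive.
Import Order.TTheory GRing.Theory Num.Theory.
Import numFieldNormedType.Exports.
Local Open Scope classical_set_scope.
Local Open Scope ring_scope.
Local Open Scope complex_scope.

Notation borel T := (g_sigma_algebraType (@open T)).

Section Entropy.
Variable R : realType.

(* The member of the n-fold join of the family U and its pull-backs under
   f, f^2, .., f^(n-1) that is labelled by a. *)
Definition join_cell (T : Type) (f : T -> T) (k : nat) (U : 'I_k -> set T)
    (n : nat) (a : {ffun 'I_n -> 'I_k}) : set T :=
  [set x | forall i : 'I_n, U (a i) (iter i f x)].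

(* Least cardinality of a subcover of the n-fold join; when U covers T the
   default value of the minimum is attained by the whole join. *)
Definition subcover_number (T : Type) (f : T -> T) (k : nat)
    (U : 'I_k -> set T) (n : nat) : nat :=
  \big[minn/#|{ffun 'I_n -> 'I_k}|]_(S : {set {ffun 'I_n -> 'I_k}} |
      `[< forall x, exists2 a, a \in S & join_cell f U a x >]) #|S|.

(* Adler-Konheim-McAndrew entropy (for compact T, finite open covers suffice).
   The sequence is subadditive before division by n, so the limit superior
   is a limit. *)
Definition topological_entropy (T : topologicalType) (f : T -> T) : \bar R :=
  ereal_sup [set h | exists (k : nat) (U : 'I_k -> set T),
    [/\ forall i, open (U i),
        \bigcup_i U i = [set: T] &
        h = limn_esup (fun n => (ln (subcover_number f U n)%:R / n%:R)%:E)]].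

(* Here [ln 0 = 0], which gives the usual convention 0 ln 0 = 0. *)
Definition join_entropy disp (T : measurableType disp)
    (m : {measure set T -> \bar R}) (f : T -> T) (k : nat)
    (P : 'I_k -> set T) (n : nat) : R :=
  - \sum_(a : {ffun 'I_n -> 'I_k})
      fine (m (join_cell f P a)) * ln (fine (m (join_cell f P a))).

(* Kolmogorov-Sinai entropy; again the limit superior is a limit, when f
   preserves m. *)
Definition measure_entropy disp (T : measurableType disp)
    (m : {measure set T -> \bar R}) (f : T -> T) : \bar R :=
  ereal_sup [set h | exists (k : nat) (P : 'I_k -> set T),
    [/\ forall i, measurable (P i),
        trivIset [set: 'I_k] P,
        \bigcup_i P i = [set: T] &
        h = limn_esup (fun n => (join_entropy m f P n / n%:R)%:E)]].

Definition is_measure_of_maximal_entropy (T : ptopologicalType) (f : T -> T)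
    (nu : probability (borel T) R) : Prop :=
  (forall B : set (borel T), measurable B -> nu (f @^-1` B) = nu B) /\
  measure_entropy nu f = topological_entropy f.

End Entropy.

Section Circle.
Variable R : realType.

Definition circle : Type := set_type [set z : R[i]^o | `|z| = 1].

HB.instance Definition _ := Topological.copy circle
  (set_type [set z : R[i]^o | `|z| = 1]).

Lemma circle1_subproof : (1 : R[i]^o) \in [set z : R[i]^o | `|z| = 1].
Proof. by apply/mem_set => /=; rewrite normr1. Qed.

HB.instance Definition _ := isPointed.Build circle
  (exist _ (1 : R[i]^o) circle1_subproof).

Definition circle_val (z : circle) : R[i] := set_val z.

Definition expi (t : R) : R[i] := cos t +i* sin t.

(* The tangents to the unit circle at a and b meet at 2ab/(a+b) (if a + b is
   nonzero); the hyperbolic geodesic from a to b lies on the circle around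
   that point which is orthogonal to the unit circle, cf.
   [orthocircle_endpoints]. *)
Definition orthocenter (a b : R[i]) : R[i] := 2 * a * b / (a + b).
Definition orthoradius2 (a b : R[i]) : R[i] := `|orthocenter a b| ^+ 2 - 1.

Definition geodesic_reflection (a b z : R[i]) : R[i] :=
  orthocenter a b + orthoradius2 a b / (z - orthocenter a b)^*%R.

Lemma orthocenterC a b : orthocenter a b = orthocenter b a.
Proof. by rewrite /orthocenter -!mulrA (addrC b) [a * (b * _)]mulrCA. Qed.

Lemma orthocircle_endpoints (a b : R[i]) : `|a| = 1 -> `|b| = 1 ->
  a + b != 0 -> `|a - orthocenter a b| ^+ 2 = orthoradius2 a b.
Proof.
move=> a1 b1 ab0.
have conj1 (x : R[i]) : `|x| = 1 -> x != 0 /\ (x^*)%R = x^-1.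
  move=> x1; have x0 : x != 0 by rewrite -normr_gt0 x1.
  split=> //; apply: (mulfI x0).
  by rewrite -normCK x1 expr1n divff.
have [a0 aE] := conj1 _ a1; have [b0 bE] := conj1 _ b1.
rewrite /orthoradius2 !normCK /orthocenter.
rewrite !(rmorphB, rmorphM, rmorphD, fmorphV) /= rmorph1.
rewrite aE bE.
by field; rewrite a0 b0 addrC.
Qed.

Lemma geodesic_reflection_fix (a b z : R[i]) :
  `|z - orthocenter a b| ^+ 2 = orthoradius2 a b ->
  z != orthocenter a b -> geodesic_reflection a b z = z.
Proof.
move=> zr; rewrite -subr_eq0 => zc.
have zc' : (z - orthocenter a b)^*%R != 0 by rewrite fmorph_eq0.
by rewrite /geodesic_reflection -zr normCK mulfK // addrC subrK.
Qed.

Lemma geodesic_reflectionK (a b z : R[i]) : orthoradius2 a b != 0 ->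
  z != orthocenter a b ->
  geodesic_reflection a b (geodesic_reflection a b z) = z.
Proof.
move=> r0; rewrite -subr_eq0 => zc.
have rC : ((orthoradius2 a b)^*)%R = orthoradius2 a b.
  by rewrite /orthoradius2 rmorphB rmorph1 rmorphXn /= conj_normC.
rewrite /geodesic_reflection [X in (X - _)]addrC addrK.
rewrite rmorphM fmorphV /= rC conjCK invfM invrK mulrA divff // mul1r.
by rewrite addrC subrK.
Qed.

End Circle.

Section Alphabet.
Variable d : nat.

(* The letter (j, true) stands for the index j+1, (j, false) for -(j+1). *)
Definition letter : Type := ('I_d * bool)%type.
HB.instance Definition _ := Finite.copy letter ('I_d * bool)%type.

Definition inv_letter (s : letter) : letter := (s.1, ~~ s.2).

(* Elements of the free group F_d, i.e. vertices of its Cayley tree, are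
   reduced words; the letter s stands for the generator g_s. *)
Definition reduced (w : seq letter) : bool :=
  sorted (fun s t => t != inv_letter s) w.
Definition free_word : Type := {w : seq letter | reduced w}.
HB.instance Definition _ := Choice.copy free_word {w : seq letter | reduced w}.

Definition word_length (g : free_word) : nat := size (val g).

(* The union of the (vertices of the) Cayley tree and its Gromov boundary:
   finite and infinite reduced words, a word being the sequence of its letters
   followed, if it is finite, by [None].  In the topology of pointwise
   convergence the finite words are isolated, and a base of neighbourhoods of
   an infinite word is given by the sets of all words that have a given prefix
   in common with it. *)
Definition reduced_path : set {ptws nat -> discrete_topology (option letter)} :=
  [set x | forall k t, x k.+1 = Some t ->
     exists2 s, x k = Some s & t != inv_letter s].
Definition tree_completion : Type := set_type reduced_path.
HB.instance Definition _ :=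
  Topological.copy tree_completion (set_type reduced_path).

Lemma vertex_subproof (g : free_word) :
  ((fun k => onth (val g) k) : {ptws nat -> discrete_topology (option letter)})
    \in reduced_path.
Proof.
apply/mem_set => k t /=; case: g => w /=; rewrite /reduced.
elim: w k => [|s w IHw] [|k] //=; last by move/path_sorted; exact: IHw.
by case: w {IHw} => [|u w] //= /andP[us _] [<-]; exists s.
Qed.

Definition vertex (g : free_word) : tree_completion :=
  exist (fun x => x \in reduced_path) _ (vertex_subproof g).

(* The one-sided subshift.  The hypothesis 2 <= d only serves to make the type
   nonempty, hence a measurable space in the sense of the library. *)
Definition admissible : set {ptws nat -> discrete_topology letter} :=
  [set x | forall k, x k.+1 != inv_letter (x k)].
Definition subshift (hd : (2 <= d)%N) : Type := set_type admissible.

Section Subshift.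
Variable hd : (2 <= d)%N.

HB.instance Definition _ :=
  Topological.copy (subshift hd) (set_type admissible).

Lemma subshift_point_subproof :
  ((fun=> (Ordinal hd, true)) : {ptws nat -> discrete_topology letter})
    \in admissible.
Proof. by apply/mem_set => k; apply/eqP. Qed.

HB.instance Definition _ := isPointed.Build (subshift hd)
  (exist (fun x => x \in admissible) _ subshift_point_subproof).

Definition digit (x : subshift hd) (k : nat) : letter := set_val x k.

Lemma digit_admissible x k : digit x k.+1 != inv_letter (digit x k).
Proof. by case: x => x xP; have := set_mem xP; apply. Qed.

Lemma shift_subproof (x : subshift hd) :
  ((fun k => digit x k.+1) : {ptws nat -> discrete_topology letter})
    \in admissible.
Proof. by apply/mem_set => k; exact: digit_admissible. Qed.

Definition shift (x : subshift hd) : subshift hd :=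
  exist (fun x => x \in admissible) _ (shift_subproof x).

Lemma boundary_word_subproof (x : subshift hd) :
  ((fun k => Some (inv_letter (digit x k))) :
     {ptws nat -> discrete_topology (option letter)}) \in reduced_path.
Proof.
apply/mem_set => k t [<-]; exists (inv_letter (digit x k)) => //.
apply: contra_neq (digit_admissible x k) => -[ij bc].
by rewrite /inv_letter -ij -(negb_inj bc) -surjective_pairing.
Qed.

(* The identification of the subshift with the Gromov boundary, which sends
   (i_1, i_2, ..) to the infinite word g_{i_1}^-1 g_{i_2}^-1 .. *)
Definition boundary_word (x : subshift hd) : tree_completion :=
  exist (fun x => x \in reduced_path) _ (boundary_word_subproof x).

End Subshift.
End Alphabet.

Section BowenSeries.
Variables (R : realType) (d : nat).

(* p_j is the point written p_{j+1} when indices start at 1. *)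
Definition endpoint (j : nat) : R[i] := expi (pi * j%:R / d%:R).

Definition circle_arc (s : letter d) : set (circle R) :=
  [set z | exists2 t : R,
     pi * s.1%:R / d%:R <= t <= pi * s.1.+1%:R / d%:R &
     circle_val z = if s.2 then expi t else (expi t)^*%R].

(* The second branch is the inverse of the first one, because reflection and
   conjugation are involutions. *)
Definition generator (s : letter d) (z : R[i]) : R[i] :=
  let refl := geodesic_reflection (endpoint s.1) (endpoint s.1.+1) in
  if s.2 then (refl z)^*%R else refl z^*%R.

Definition is_bowen_series_map (A : circle R -> circle R) : Prop :=
  forall (s : letter d) (z : circle R), circle_arc s z ->
    circle_val (A z) = generator s (circle_val z).

Definition is_cannon_thurston_map (hd : (2 <= d)%N)
    (A : circle R -> circle R) (psi : subshift hd -> circle R) : Prop :=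
  [/\ continuous psi,
      range psi = [set: circle R],
      forall x, psi (shift x) = A (psi x) &
      forall s, psi @` [set x | digit x 0 = s] = circle_arc s].

End BowenSeries.

Section PattersonSullivan.
Variables (R : realType) (d : nat) (hd : (2 <= d)%N).

Definition ball_weight (n : nat) : R :=
  \sum_(g \in [set g : free_word d | (word_length g <= n)%N])
    ((2 * d - 1)%N%:R ^- word_length g : R).

(* The integral of f with respect to the n-th approximating probability
   measure. *)
Definition ball_average (n : nat) (f : tree_completion d -> R) : R :=
  (\sum_(g \in [set g : free_word d | (word_length g <= n)%N])
    ((2 * d - 1)%N%:R ^- word_length g * f (vertex g))) / ball_weight n.

(* A measure on the boundary (in the coordinates given by the subshift) whose
   image in the completed tree is the weak limit of the approximating
   measures. *)
Definition is_patterson_sullivan (mu : probability (borel (subshift hd)) R) :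
    Prop :=
  forall f : tree_completion d -> R, continuous f ->
    ball_average n f @[n --> \oo] --> \int[mu]_x f (boundary_word (x : subshift hd)).

End PattersonSullivan.

(* Main.v *)
(** Let [m = 2d - 1].  Every measure of maximal entropy of [A] gives the same
mass to all nonempty cells of a given length of a Markov partition by half-open
arcs, for the following reason.  For a substochastic kernel [k] that predicts the label of [x]
from the labels of [A x], [A (A x)], .., Gibbs' inequality bounds the entropy of
the measure by the mean of [- ln k].  The uniform kernel on the [m] admissible
letters gives the bound [ln m].  The map [A] has topological entropy at least
[ln m], because a suitable open cover separates the [m ^ n] preimages of a point
under [A ^ n].  Hence tilting the uniform kernel, by [1 + t * phi], cannot improve
the bound; letting [t] tend to 0 shows that [phi] has mean zero, so that the
admissible extensions of a cell by one letter to the left have equal mass, and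
invariance determines the mass of the cells.

The Patterson-Sullivan measure of a cylinder is found by counting reduced words
with a given prefix.  It agrees with the mass of the cell with the same labels, so
that it is the distribution of the itinerary, which is a section of [psi].

The geometry enters only through three facts: two arcs meet only if they are neighbours,
[A] is complex conjugation at points on two arcs, and [A] is injective on
each arc.  The rest follows from the semiconjugacy [psi]. *)

Require Import Defs.
From mathcomp Require Import all_boot all_order all_algebra.
From mathcomp Require Import complex.
From mathcomp Require Import all_classical all_reals all_analysis.
From mathcomp Require Import ring lra zify.
Set Implicit Arguments.
Unset Strict Implicit.
Unset Printing Implicit Defensive.
Import Order.TTheory GRing.Theory Num.Theory.
Import numFieldNormedType.Exports.
Local Open Scope classical_set_scope.
Local Open Scope ring_scope.

(** * Letters and arcs *)

Section Letters.
Variable d : nat.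
Implicit Types s t : letter d.

Lemma inv_letterK : involutive (@inv_letter d).
Proof. by case=> j b; rewrite /inv_letter /= negbK. Qed.

Lemma inv_letter_inj : injective (@inv_letter d).
Proof. exact: inv_inj inv_letterK. Qed.

Lemma inv_letter_neq s : inv_letter s != s.
Proof. by apply/eqP => -[] /(congr1 snd) /=; case: s.2. Qed.

Lemma inv_letter_sym s t : (t != inv_letter s) = (s != inv_letter t).
Proof. by rewrite eq_sym (can2_eq inv_letterK inv_letterK). Qed.

(* The arc that follows that of s, counter-clockwise. *)
Definition next_letter s : letter d :=
  if s.2 then
    if insub s.1.+1 is Some j then (j, true) else (s.1, false)
  else (insubd s.1 s.1.-1, s.1 == 0%N :> nat).

(** The rank of the arc of [s] in counter-clockwise order from the point 1. It turns the cyclic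
    order of the arcs into arithmetic modulo [2 * d]. *)
Definition position s : nat := if s.2 then nat_of_ord s.1 else (2 * d - 1 - s.1)%N.

Lemma position_inj : injective position.
Proof.
move=> -[i b] [j c]; rewrite /position /= => ij.
suff [ijE ->] : i = j :> nat /\ b = c by rewrite (val_inj ijE).
have := ltn_ord i; have := ltn_ord j; move: ij.
by case: b; case: c => //= ? ? ?; split; lia.
Qed.

Lemma position_lt s : (position s < 2 * d)%N.
Proof. by rewrite /position; have := ltn_ord s.1; case: s.2 => /=; lia. Qed.

Lemma position_next s : position (next_letter s) = ((position s).+1 %% (2 * d))%N.
Proof.
rewrite /position /next_letter; case: s => j [] /=.
  case: insubP => [i _ /= iE|]; first by have := ltn_ord i; rewrite iE => ?; rewrite modn_small; lia.
  by have := ltn_ord j => ? ? /=; rewrite modn_small; lia.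
have jd := ltn_ord j.
rewrite /insubd insubT /=; first lia.
move=> ?; case: eqP => [j0|j0] /=.
  by rewrite j0 subn0 subn1 prednK ?modnn; lia.
by rewrite modn_small; lia.
Qed.

(** Complex conjugation sends position [p] to [2 * d - 1 - p], hence reverses the cyclic order. *)
Lemma next_letter_inv s : next_letter (inv_letter (next_letter s)) = inv_letter s.
Proof.
have pinv u : position (inv_letter u) = (2 * d - 1 - position u)%N.
  by rewrite /position; have := ltn_ord u.1; case: u => j [] /=; lia.
apply: position_inj; rewrite position_next !pinv position_next.
have := position_lt s; case: (ltnP (position s).+1 (2 * d)) => [sd _|sd sd'].
  by rewrite (modn_small sd) modn_small; lia.
have -> : (position s).+1 = (2 * d)%N by lia.
by rewrite modnn subn0 subn1 prednK ?modnn; lia.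
Qed.

Lemma position_next_iter k s :
  position (iter k next_letter s) = ((position s + k) %% (2 * d))%N.
Proof.
elim: k => [|k IH] /=; first by rewrite addn0 modn_small // position_lt.
by rewrite position_next IH -addn1 modnDml addn1 addnS.
Qed.

Lemma next_letter_inj : injective next_letter.
Proof.
by move=> s t st; apply: inv_letter_inj; rewrite -next_letter_inv st next_letter_inv.
Qed.

(** The arcs form a single cycle of length [2 * d]. As this length is at least 4, the lemma is
    available for [k] up to 3. *)
Lemma iter_next_neq k s : (0 < k < 2 * d)%N -> iter k next_letter s != s.
Proof.
move=> k0; apply/negP => /eqP /(congr1 position); rewrite position_next_iter.
have ps := position_lt s => h.
case: (ltnP (position s + k) (2 * d)) => pk; first by move: h; rewrite modn_small //; lia.
have e : (position s + k = (position s + k - 2 * d) + 2 * d)%N by lia.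
by move: h; rewrite e modnDr modn_small; lia.
Qed.

End Letters.

(** * The Bowen-Series map on arcs and their endpoints *)

Section Geometry.
Variables (R : realType) (d : nat).
Hypothesis hd : (2 <= d)%N.
Implicit Types s t : letter d.
Implicit Types z : circle R.
Local Open Scope complex_scope.

Lemma circle_val_inj : injective (@circle_val R).
Proof. exact: val_inj. Qed.

Lemma normr_circle z : `|circle_val z| = 1.
Proof. by case: z => z hz; have := set_mem hz. Qed.

Lemma pi_mesh_le j : (j <= d)%N -> 0 <= (pi : R) * j%:R / d%:R <= pi.
Proof.
move=> jd; have d0 : 0 < d%:R :> R by rewrite ltr0n; lia.
apply/andP; split; first by rewrite divr_ge0 ?mulr_ge0 ?pi_ge0 ?ler0n.
by rewrite ler_pdivrMr // ler_wpM2l ?pi_ge0 // ler_nat.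
Qed.

Lemma pi_mesh_leq i j : ((pi : R) * i%:R / d%:R <= pi * j%:R / d%:R) = (i <= j)%N.
Proof.
have d0 : 0 < d%:R :> R by rewrite ltr0n; lia.
by rewrite ler_pM2r ?invr_gt0 // ler_pM2l ?pi_gt0 // ler_nat.
Qed.

Lemma pi_mesh_inj i j : (pi : R) * i%:R / d%:R = pi * j%:R / d%:R -> i = j.
Proof.
by move=> ij; apply/eqP; rewrite eqn_leq -!pi_mesh_leq ij lexx.
Qed.

Lemma expi_inj (x y : R) : 0 <= x <= pi -> 0 <= y <= pi -> expi x = expi y -> x = y.
Proof. by move=> hx hy [cxy _]; apply: cos_inj => //; rewrite in_itv. Qed.

(** The closed upper and lower half circles share only 1 and -1. *)
Lemma expi_conj (x y : R) : 0 <= x <= pi -> 0 <= y <= pi ->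
  expi x = (expi y)^*%R -> x = y /\ (x = 0 \/ x = pi).
Proof.
move=> hx hy [cxy sxy]; have xy : x = y by apply: cos_inj => //; rewrite in_itv.
split=> //; subst y.
have s0 : sin x = 0 by move: sxy; lra.
have [->|x0] := eqVneq x 0; [by left|right].
apply/eqP; rewrite eq_le (andP hx).2 /= leNgt; apply/negP => xpi.
have : 0 < sin x by apply: sin_gt0_pi => //; rewrite lt_neqAle eq_sym x0 (andP hx).1.
by rewrite s0 ltxx.
Qed.

Lemma next_letterP s t : position t = (position s).+1 \/
  (position t = 0 /\ position s = 2 * d - 1)%N -> t = next_letter s.
Proof.
move=> h; apply: position_inj; rewrite position_next.
have := position_lt t; case: h => [<- ?|[-> -> _]]; first by rewrite modn_small.
by rewrite subn1 prednK ?modnn; lia.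
Qed.

Lemma pi_mesh0 : (pi : R) * 0%:R / d%:R = 0.
Proof. by rewrite mulr0 mul0r. Qed.

Lemma pi_meshd : (pi : R) * d%:R / d%:R = pi.
Proof. by rewrite mulfK // pnatr_eq0; lia. Qed.

Lemma circle_arc_meet s t z : circle_arc s z -> circle_arc t z -> s != t ->
  (t = next_letter s \/ s = next_letter t) /\
  (if s.2 then circle_val z else (circle_val z)^*%R)
    \in [:: endpoint R d s.1; endpoint R d s.1.+1].
Proof.
case: s t => [i b] [j c] [/= x xi zx] [/= y yj zy] st.
have hi := ltn_ord i; have hj := ltn_ord j.
have itvW k u : (k < d)%N ->
    pi * k%:R / d%:R <= u <= pi * k.+1%:R / d%:R -> 0 <= u <= (pi : R).
  move=> kd /andP[ku uk].
  have /andP[k0 _] := pi_mesh_le (ltnW kd); have /andP[_ k1] := pi_mesh_le kd.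
  by rewrite (le_trans k0 ku) (le_trans uk k1).
have x0 := itvW _ _ hi xi; have y0 := itvW _ _ hj yj.
(* On the same half circle the angles agree, so two different mesh intervals share an angle, which
   must be a mesh point. On opposite halves only the angles 0 and pi are possible. *)
have [bc|bc] := eqVneq b c.
  subst c.
  have wE : (if b then circle_val z else (circle_val z)^*%R) = expi x.
    by rewrite zx; case: b {st zx zy} => //; rewrite conjCK.
  have xy : x = y.
    apply: expi_inj => //; rewrite -wE zy; case: b {st zx zy wE} => //; exact: conjCK.
  subst y; rewrite wE.
  have ij : i <> j :> nat by move=> /val_inj ij; rewrite ij eqxx in st.
  case/andP: xi => ix xi; case/andP: yj => jx xj.
  have ij1 : (i <= j.+1)%N by rewrite -pi_mesh_leq (le_trans ix).
  have ji1 : (j <= i.+1)%N by rewrite -pi_mesh_leq (le_trans jx).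
  have [jE|iE] : j = i.+1 :> nat \/ i = j.+1 :> nat by lia.
  - split; last first.
      rewrite !inE /endpoint; apply/orP; right; apply/eqP; congr expi.
      by apply/eqP; rewrite eq_le xi -jE jx.
    by case: b {st zx zy wE}; [left|right]; apply: next_letterP; left; rewrite /position /=; lia.
  - split; last first.
      rewrite !inE /endpoint; apply/orP; left; apply/eqP; congr expi.
      by apply/eqP; rewrite eq_le ix iE xj.
    by case: b {st zx zy wE}; [right|left]; apply: next_letterP; left; rewrite /position /=; lia.
have [xy xE] : x = y /\ (x = 0 \/ x = pi).
  apply: expi_conj => //; move: zx; rewrite zy.
  by case: b c bc {st zy} => [] [] //= _ /(congr1 Num.conj); rewrite !conjCK.
subst y.
have wE : (if b then circle_val z else (circle_val z)^*%R) = expi x.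
  by rewrite zx; case: b {st zx zy bc} => //; rewrite conjCK.
rewrite wE.
case/andP: xi => ix xi; case/andP: yj => jx xj.
case: xE => xE.
- have i0 : i = 0%N :> nat.
    by apply/eqP; rewrite -leqn0 -pi_mesh_leq pi_mesh0 -xE.
  have j0 : j = 0%N :> nat.
    by apply/eqP; rewrite -leqn0 -pi_mesh_leq pi_mesh0 -xE.
  split; last by rewrite !inE /endpoint i0 pi_mesh0 xE eqxx.
  case: b c bc {st zx zy wE} => [] [] //= _; [right|left];
    by apply: next_letterP; right; rewrite /position /=; lia.
- have i0 : i.+1 = d.
    by apply/eqP; rewrite eqn_leq hi -pi_mesh_leq pi_meshd -[X in X <= _]xE.
  have j0 : j.+1 = d.
    by apply/eqP; rewrite eqn_leq hj -pi_mesh_leq pi_meshd -[X in X <= _]xE.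
  split; last by rewrite !inE /endpoint i0 pi_meshd xE eqxx orbT.
  case: b c bc {st zx zy wE} => [] [] //= _; [left|right];
    by apply: next_letterP; left; rewrite /position /=; lia.
Qed.

Lemma endpoint_norm j : `|endpoint R d j| = 1.
Proof.
rewrite /endpoint /expi normc_def /=; congr (_ +i* _).
by rewrite cos2Dsin2 sqrtr1.
Qed.

Lemma endpoint_neq j : (j < d)%N -> endpoint R d j != endpoint R d j.+1.
Proof.
move=> jd; apply/eqP => /expi_inj; rewrite !pi_mesh_le //; last exact: ltnW.
by move=> /(_ erefl erefl) /pi_mesh_inj; lia.
Qed.

(** If consecutive endpoints were antipodal, both sines, being nonnegative, would vanish, and the
    angles would be 0 and pi; these are consecutive mesh points only for [d = 1]. Hence
    [orthocenter] is a genuine centre. *)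
Lemma endpoint_add_neq0 j : (j < d)%N -> endpoint R d j + endpoint R d j.+1 != 0.
Proof.
move=> jd; apply/eqP => -[+ +].
set x := pi * _ / _; set y := pi * _ / _ => cxy sxy.
have hx : 0 <= x <= pi by apply: pi_mesh_le; lia.
have hy : 0 <= y <= pi by exact: pi_mesh_le.
have sx := sin_ge0_pi hx; have sy := sin_ge0_pi hy.
(* A point of vanishing sine is its own conjugate, so [expi_conj] applied to [x] twice leaves only 0
   and pi. *)
have [_ xE] : x = x /\ (x = 0 \/ x = pi).
  by apply: expi_conj => //; congr (_ +i* _); lra.
have xN : x != pi.
  by apply/eqP; rewrite -[RHS]pi_meshd => /pi_mesh_inj; lia.
have {xE}x0 : x = 0 by case: xE => // xE; rewrite xE eqxx in xN.
have j0 : j = 0%N by move: x0; rewrite -[RHS]pi_mesh0 => /pi_mesh_inj.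
have [_ yE] : y = y /\ (y = 0 \/ y = pi).
  by apply: expi_conj => //; congr (_ +i* _); lra.
case: yE; [rewrite -[RHS]pi_mesh0|rewrite -[RHS]pi_meshd] => /pi_mesh_inj; lia.
Qed.

Lemma orthocenter_neq (a b : R[i]) : a != 0 -> a != b -> a + b != 0 ->
  a != orthocenter a b.
Proof.
move=> a0 ab ab0; rewrite -subr_eq0 /orthocenter.
suff -> : a - 2 * a * b / (a + b) = a * (a - b) / (a + b).
  by rewrite !mulf_neq0 ?invr_eq0 // subr_eq0.
by field.
Qed.

Lemma geodesic_reflection_end (a b : R[i]) : `|a| = 1 -> `|b| = 1 -> a != b ->
  a + b != 0 -> geodesic_reflection a b a = a /\ geodesic_reflection a b b = b.
Proof.
move=> a1 b1 ab ab0.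
have n0 (x : R[i]) : `|x| = 1 -> x != 0 by move=> x1; rewrite -normr_gt0 x1.
split; apply: geodesic_reflection_fix; rewrite ?orthocircle_endpoints //.
- by apply: orthocenter_neq => //; exact: n0.
- rewrite orthocenterC orthocircle_endpoints // 1?addrC //.
  by rewrite /orthoradius2 orthocenterC.
- by rewrite orthocenterC; apply: orthocenter_neq; [exact: n0|rewrite eq_sym|rewrite addrC].
Qed.

(** The reflection is an involution away from its centre, and the centre is not on the unit circle,
    because the radius would then vanish. *)
Lemma geodesic_reflection_inj (a b z w : R[i]) : `|a| = 1 -> `|b| = 1 -> a != b ->
  a + b != 0 -> `|z| = 1 -> `|w| = 1 ->
  geodesic_reflection a b z = geodesic_reflection a b w -> z = w.
Proof.
move=> a1 b1 ab ab0 z1 w1.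
have a0 : a != 0 by rewrite -normr_gt0 a1.
have r0 : orthoradius2 a b != 0.
  rewrite -orthocircle_endpoints // expf_neq0 // normr_eq0 subr_eq0.
  exact: orthocenter_neq.
have nc x : `|x| = 1 -> x != orthocenter a b.
  move=> x1; apply: contra_neq r0 => xE.
  by rewrite /orthoradius2 -xE x1 expr1n subrr.
move=> /(congr1 (geodesic_reflection a b)).
by rewrite !geodesic_reflectionK ?nc.
Qed.

Variable A : circle R -> circle R.
Hypothesis hA : is_bowen_series_map d A.

(** A common point of two arcs is an end of the geodesic, so the reflection fixes it and only the
    conjugation remains of the generator. *)
Lemma bowen_series_meet s t z : circle_arc s z -> circle_arc t z -> s != t ->
  circle_val (A z) = (circle_val z)^*%R.
Proof.
move=> sz tz st; rewrite (hA sz) /generator.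
have [_] := circle_arc_meet sz tz st; have hs := ltn_ord s.1.
have [fa fb] := geodesic_reflection_end (endpoint_norm s.1) (endpoint_norm s.1.+1)
  (endpoint_neq hs) (endpoint_add_neq0 hs).
rewrite !inE; case: s.2 => /orP[] /eqP ->; by rewrite ?fa ?fb.
Qed.

Lemma bowen_series_inj s z w : circle_arc s z -> circle_arc s w -> A z = A w -> z = w.
Proof.
move=> sz sw /(congr1 (@circle_val R)); rewrite (hA sz) (hA sw) /generator.
have hs := ltn_ord s.1.
have inj := geodesic_reflection_inj (endpoint_norm s.1) (endpoint_norm s.1.+1)
  (endpoint_neq hs) (endpoint_add_neq0 hs).
case: s.2.
- move=> /(can_inj (@conjCK _)) /inj h; apply: circle_val_inj; apply: h; exact: normr_circle.
- move=> /inj h; apply: circle_val_inj; apply: (can_inj (@conjCK _)).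
  by apply: h; rewrite norm_conjC; exact: normr_circle.
Qed.

Lemma circle_arc_conj s z w : circle_val w = (circle_val z)^*%R ->
  circle_arc s z -> circle_arc (inv_letter s) w.
Proof.
move=> wz [x xs zx]; exists x => //=; rewrite wz zx.
by case: s.2 => //=; rewrite conjCK.
Qed.

(** Three different arcs through one point would be pairwise neighbours, hence a cycle of length 3
    under [next_letter], whose only cycle has length at least 4. *)
Lemma circle_arc_triple s t u z : circle_arc s z -> circle_arc t z -> circle_arc u z ->
  s != t -> u = s \/ u = t.
Proof.
move=> sz tz uz st; apply: contrapT => /not_orP[/eqP us /eqP ut].
have [nst _] := circle_arc_meet sz tz st.
have [nus _] := circle_arc_meet uz sz us.
have [nut _] := circle_arc_meet uz tz ut.
have cyc (a : letter d) : next_letter (next_letter (next_letter a)) <> a.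
  by apply/eqP/(@iter_next_neq _ 3); lia.
have inj := @next_letter_inj d.
move/eqP: st => st.
case: nst => nst; case: nus => nus; case: nut => nut;
  first [congruence | by apply: (cyc s); congruence | by apply: st; apply: inj; congruence
        | by apply: us; apply: inj; congruence | by apply: ut; apply: inj; congruence].
Qed.

End Geometry.

(** * The subshift *)

Section SequenceSpaces.
Variables (T : choiceType) (S : set {ptws nat -> discrete_topology T}).
Local Notation X := (set_type S).

Lemma coord_continuous k :
  continuous (fun x : X => (set_val x k : discrete_topology T)).
Proof.
move=> x; apply: (@continuous_comp _ _ _ (set_val : X -> {ptws nat -> discrete_topology T})
  (fun f : {ptws nat -> discrete_topology T} => f k)).
  exact: initial_continuous.
exact: (@proj_continuous nat (fun=> discrete_topology T) k).
Qed.

Lemma coord_open k (D : set T) : open [set x : X | D (set_val x k)].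
Proof.
have /continuousP := @coord_continuous k.
by apply; exact: (@discrete_open (discrete_topology T)).
Qed.

Lemma prefix_open (x : X) n :
  open [set y : X | forall i, (i < n)%N -> set_val y i = set_val x i].
Proof.
elim: n => [|n IH].
  by rewrite (_ : [set _ | _] = setT); [exact: openT|apply/seteqP; split].
rewrite (_ : [set _ | _] =
  [set y : X | forall i, (i < n)%N -> set_val y i = set_val x i] `&`
  [set y : X | [set set_val x n] (set_val y n)]).
  by apply: openI => //; exact: (coord_open n [set set_val x n]).
apply/seteqP; split=> y /=.
  by move=> h; split=> [i ni|]; apply: h => //; exact: ltnW.
by move=> [h hn] i; rewrite ltnS leq_eqVlt => /orP[/eqP ->|/h].
Qed.

(** Otherwise there are points outside [U] that agree with [x] on longer and longer prefixes; they
    converge to [x] pointwise and so enter [U]. *)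
Lemma nbhs_prefix (x : X) (U : set X) : nbhs x U ->
  exists n, forall y : X, (forall i, (i < n)%N -> set_val y i = set_val x i) -> U y.
Proof.
move=> xU; apply: contrapT => /forallNP nU.
have /choice[y hy] : forall n, exists y : X,
    (forall i, (i < n)%N -> set_val y i = set_val x i) /\ ~ U y.
  move=> n; have /existsNP[y] := nU n.
  by move=> /not_implyP[yx Uy]; exists y.
case: xU => _ [[V oV <-] Vx VU].
have : (fun n => set_val (y n)) @ \oo --> (set_val x : {ptws nat -> discrete_topology T}).
  apply/(@pointwise_cvgP nat (discrete_topology T)) => k.
  apply/(@discrete_cvg (discrete_topology T)).
  by exists k.+1 => // n /= kn; apply: (hy n).1.
move=> /(_ V); case; first exact: open_nbhs_nbhs.
move=> N _ /(_ N (leqnn N)) VN.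
by apply: (hy N).2; apply: VU.
Qed.

End SequenceSpaces.

Section Subshift.
Variables (d : nat) (hd : (2 <= d)%N).
Implicit Types (s t : letter d) (x y : subshift hd).

Lemma digit_open k (D : set (letter d)) : open [set x : subshift hd | D (digit x k)].
Proof. exact: (@coord_open _ (@admissible d)). Qed.

Lemma nbhs_digits x (U : set (subshift hd)) : nbhs x U ->
  exists n, forall y, (forall i, (i < n)%N -> digit y i = digit x i) -> U y.
Proof. exact: (@nbhs_prefix _ (@admissible d)). Qed.

Lemma subshiftP x y : (forall i, digit x i = digit y i) -> x = y.
Proof. by move=> h; apply: val_inj; apply/funext. Qed.

Definition subshift_of (f : nat -> letter d)
    (hf : forall k, f k.+1 != inv_letter (f k)) : subshift hd :=
  exist (fun w => w \in @admissible d) (f : {ptws nat -> discrete_topology (letter d)})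
    (mem_set hf).

Lemma prepend_subproof s x : digit x 0 != inv_letter s ->
  forall k, (fun i => if i is i'.+1 then digit x i' else s) k.+1 !=
    inv_letter ((fun i => if i is i'.+1 then digit x i' else s) k).
Proof. by move=> h [|k] //; exact: digit_admissible. Qed.

Definition prepend s x (h : digit x 0 != inv_letter s) : subshift hd :=
  subshift_of (prepend_subproof h).

Lemma digit_shift x k : digit (Defs.shift x) k = digit x k.+1.
Proof. by []. Qed.

Lemma digit_iter_shift x n k : digit (iter n (@Defs.shift d hd) x) k = digit x (k + n).
Proof. by elim: n k => [|n IH] k; rewrite ?addn0 // iterS digit_shift IH addSnnS. Qed.

Lemma shift_prepend s x (h : digit x 0 != inv_letter s) : Defs.shift (prepend h) = x.
Proof. exact: subshiftP. Qed.

(** The alphabet being finite, an ultrafilter selects one letter at each coordinate. Two consecutive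
    selections occur in a common admissible sequence, so the selected sequence is admissible, and it
    is the limit. *)
Lemma compact_subshift : compact [set: subshift hd].
Proof.
rewrite compact_ultra => F FU _.
have dig k : exists s, F [set x : subshift hd | digit x k = s].
  apply: contrapT => /forallNP nF.
  have : F (\big[setI/setT]_(s <- enum {: letter d}) ~` [set x : subshift hd | digit x k = s]).
    apply: (big_ind (fun A => F A)); [exact: filterT|by move=> A B; exact: filterI|].
    move=> s _.
    by have [/nF|] := in_ultra_setVsetC [set x : subshift hd | digit x k = s] FU.
  rewrite (_ : \big[_/_]_(_ <- _) _ = set0); first exact: filter_not_empty.
  rewrite -subset0 => x; rewrite -bigcap_seq => /(_ (digit x k)) h.
  by apply: h => //=; rewrite mem_enum.
have [f hf] := choice dig.
have fa k : f k.+1 != inv_letter (f k).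
  have [x [xk xk1]] : ([set x : subshift hd | digit x k = f k] `&`
      [set x : subshift hd | digit x k.+1 = f k.+1]) !=set0.
    by apply: (@filter_ex _ F); apply: (@filterI _ F); exact: hf.
  by rewrite -xk -xk1; exact: digit_admissible.
exists (subshift_of fa); split=> // U /nbhs_digits[n nU].
apply: filterS nU _.
elim: n => [|n IH]; first by apply: filterS filterT => x _ i.
apply: (filterS _ (@filterI _ F _ _ _ IH (hf n))) => x [/= xi xn] i.
by rewrite ltnS leq_eqVlt => /orP[/eqP ->|/xi].
Qed.

End Subshift.

Lemma hausdorff_circle (R : realType) : hausdorff_space (circle R).
Proof.
rewrite open_hausdorff => x y xy.
have := @norm_hausdorff _ (R[i]^o); rewrite open_hausdorff.
move=> /(_ (circle_val x) (circle_val y)); case.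
  by apply: contra_neq xy => /circle_val_inj.
move=> [U V] /= [xU yV] [oU oV UV].
exists (set_val @^-1` U, set_val @^-1` V).
  by split; rewrite inE /=; [have := set_mem xU|have := set_mem yV].
split; [by exists U|by exists V|].
by rewrite -preimage_setI (eqP UV) preimage_set0.
Qed.

(** * Coding of the circle *)

Section Coding.
Variables (R : realType) (d : nat) (hd : (2 <= d)%N).
Variables (A : circle R -> circle R) (psi : subshift hd -> circle R).
Hypotheses (hA : is_bowen_series_map d A) (hpsi : is_cannon_thurston_map A psi).
Implicit Types (s t : letter d) (x y z : circle R) (w : subshift hd).

Lemma psi_continuous : continuous psi. Proof. by case: hpsi. Qed.

Lemma psi_surj z : exists w, psi w = z.
Proof.
case: hpsi => _ r _ _; have : range psi z by rewrite r.
by move=> [w _ <-]; exists w.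
Qed.

Lemma psi_shift w : psi (Defs.shift w) = A (psi w). Proof. by case: hpsi. Qed.

Lemma circle_arcE s : circle_arc s = psi @` [set w | digit w 0 = s].
Proof. by case: hpsi. Qed.

Lemma psi_arc w : circle_arc (digit w 0) (psi w).
Proof. by rewrite circle_arcE; exists w. Qed.

(** A common image would lie on the arcs of both first digits, where [A] is conjugation; it would
    then also lie on the arc inverse to the second digit. Three arcs cannot meet, so this inverse is
    one of the two first digits, against admissibility. *)
Lemma psi_neq w w' : digit w 0 != digit w' 0 -> Defs.shift w = Defs.shift w' ->
  psi w <> psi w'.
Proof.
move=> ww' sh e.
have az : circle_arc (digit w 0) (psi w) by exact: psi_arc.
have az' : circle_arc (digit w' 0) (psi w) by rewrite e; exact: psi_arc.
have Az : circle_val (A (psi w)) = (circle_val (psi w))^*%R.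
  exact: bowen_series_meet az az' ww'.
have : circle_arc (inv_letter (digit w 1)) (psi w).
  apply: (@circle_arc_conj _ _ _ (A (psi w))); first by rewrite Az conjCK.
  by rewrite -psi_shift; exact: (psi_arc (Defs.shift w)).
move=> /(circle_arc_triple hd az az') /(_ ww').
have := digit_admissible w 0; have := digit_admissible w' 0.
have -> : digit w' 1 = digit w 1 by rewrite -!digit_shift sh.
by move=> n1 n2 [h|h]; [move: n2|move: n1]; rewrite -h inv_letterK eqxx.
Qed.

Lemma circle_arc_ex z : exists s, circle_arc s z.
Proof. by have [w <-] := psi_surj z; exists (digit w 0); exact: psi_arc. Qed.

(* The arc of s without its counter-clockwise end. *)
Definition half_arc s : set (circle R) := circle_arc s `\` circle_arc (next_letter s).

(** Three consecutive arcs have no common point, so it suffices to move on at most once from an arc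
    through [z]. *)
Lemma half_arc_ex z : exists s, half_arc s z.
Proof.
have [s sz] := circle_arc_ex z.
have [nsz|] := pselect (circle_arc (next_letter s) z); last by exists s.
have [nnsz|] := pselect (circle_arc (next_letter (next_letter s)) z);
  last by exists (next_letter s).
have s_ns : s != next_letter s by rewrite eq_sym (@iter_next_neq _ 1); lia.
have ns_nns u : next_letter (next_letter u) <> u :> letter d.
  by apply/eqP/(@iter_next_neq _ 2); lia.
have [/ns_nns//|/next_letter_inj h] := circle_arc_triple hd sz nsz nnsz s_ns.
by rewrite h eqxx in s_ns.
Qed.

Lemma half_arc_inj s t z : half_arc s z -> half_arc t z -> s = t.
Proof.
move=> [sz nsz] [tz ntz]; apply/eqP; apply/negPn/negP => st.
by have [[E|E] _] := circle_arc_meet hd sz tz st; [apply: nsz|apply: ntz]; rewrite -E.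
Qed.

(* This is where it matters that all half-open arcs are open at the same end:
   otherwise the itineraries of the endpoints would not be admissible. *)
Lemma half_arc_step s z : half_arc s z -> ~ half_arc (inv_letter s) (A z).
Proof.
move=> [sz nsz] [sy nsy].
have : circle_arc s z by []; rewrite circle_arcE => -[w /= w0 wz].
set t := digit w 1; set y := A z.
have ty : circle_arc t y by rewrite /y -wz -psi_shift; exact: (psi_arc (Defs.shift w)).
have ts : t != inv_letter s by rewrite -w0; exact: digit_admissible.
have yE := bowen_series_meet hd hA ty sy ts.
have s_y : circle_arc s (A y) by rewrite -[s]inv_letterK; exact: circle_arc_conj yE sy.
have t_y : circle_arc (inv_letter t) (A y) by exact: circle_arc_conj yE ty.
have st : s != inv_letter t by rewrite -inv_letter_sym.
(* Both [y] and [A y] lie on two arcs, so [A] conjugates both and [y] has period two. Injectivity on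
   the arc of [s] forces [z = A y], which puts [z] on the arc of [inv_letter t] as well. Whichever
   of these neighbouring arcs comes first, half-openness fails at [z] or, by [next_letter_inv], at
   [y]. *)
have Ay : A (A y) = y.
  by apply: circle_val_inj; rewrite (bowen_series_meet hd hA s_y t_y st) yE conjCK.
have zE : z = A y by apply: (bowen_series_inj hd hA sz s_y); rewrite Ay.
rewrite -zE in t_y.
have [[E|E] _] := circle_arc_meet hd sz t_y st; first by apply: nsz; rewrite -E.
by apply: nsy; rewrite E next_letter_inv inv_letterK.
Qed.

Definition label z : letter d := sval (cid (half_arc_ex z)).

Lemma labelP z s : half_arc s z <-> label z = s.
Proof.
rewrite /label; case: cid => t /= tz; split=> [|<- //]; exact: half_arc_inj.
Qed.

Lemma label_arc z : circle_arc (label z) z.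
Proof. by have /labelP[] : label z = label z by []. Qed.

Lemma label_admissible z : label (A z) != inv_letter (label z).
Proof. by apply/eqP => /labelP; apply: half_arc_step; apply/labelP. Qed.

Definition itinerary z : subshift hd :=
  subshift_of hd (fun k => label_admissible (iter k A z)).

(** Prepend the label of [z] to a suitable preimage of [A z]: the image of the new sequence lies on
    the same arc as [z] and has the same image under [A], so it is [z]. *)
Lemma psi_prefix n z :
  exists w, psi w = z /\ forall i, (i <= n)%N -> digit w i = label (iter i A z).
Proof.
elim: n z => [|n IH] z.
  have := label_arc z; rewrite circle_arcE => -[w /= w0 wz].
  by exists w; split => // i; rewrite leqn0 => /eqP ->.
have [w [wz wi]] := IH (A z).
have h : digit w 0 != inv_letter (label z) by rewrite wi //; exact: label_admissible.
exists (prepend h); split; last by case=> // i ni; rewrite iterSr -wi.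
apply: (bowen_series_inj hd hA (psi_arc (prepend h)) (label_arc z)).
by rewrite -psi_shift shift_prepend.
Qed.

(** By [psi_prefix], points of the fibre over [z] agree with the itinerary on arbitrarily long
    prefixes; continuity of [psi] does the rest. *)
Lemma psi_itinerary z : psi (itinerary z) = z.
Proof.
apply: contrapT => h.
have cl : closed [set z].
  by apply: (compact_closed (@hausdorff_circle R)); exact: compact_set1.
have : nbhs (itinerary z) (psi @^-1` (~` [set z])).
  apply: psi_continuous; apply: open_nbhs_nbhs; split => //.
  by rewrite openC.
move=> /nbhs_digits[n nU].
have [w [wz wi]] := psi_prefix n z.
by apply: (nU w) => // i /ltnW/wi.
Qed.

Lemma psi_closed (C : set (subshift hd)) : closed C -> closed (psi @` C).
Proof.
move=> cC; apply: (compact_closed (@hausdorff_circle R)).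
apply: continuous_compact; first by apply: continuous_subspaceT; exact: psi_continuous.
by apply: (subclosed_compact cC (@compact_subshift d hd)).
Qed.

Lemma closed_circle_arc s : closed (circle_arc s : set (circle R)).
Proof.
rewrite circle_arcE; apply: psi_closed; rewrite -openC.
exact: (digit_open hd 0 (~` [set s])).
Qed.

Lemma shift_continuous : continuous (@Defs.shift d hd).
Proof.
move=> w U /nbhs_digits[n nU].
exists [set v : subshift hd | forall i, (i < n.+1)%N -> digit v i = digit w i].
  split; first exact: (@prefix_open _ (@admissible d)).
  by move=> i.
by move=> v /= vw; apply: nU => i ni; rewrite !digit_shift vw.
Qed.

(** Being closed and surjective, [psi] is a quotient map, so continuity descends from the shift
    along the semiconjugacy. *)
Lemma bowen_series_continuous : continuous A.
Proof.
apply/continuous_closedP => C cC.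
rewrite (_ : A @^-1` C = psi @` ((psi \o @Defs.shift d hd) @^-1` C)); last first.
  apply/seteqP; split=> z /=; last by move=> [w /= h <-]; rewrite -psi_shift.
  by have [w <-] := psi_surj z; rewrite -psi_shift => h; exists w.
apply: psi_closed.
have : continuous (psi \o @Defs.shift d hd).
  by move=> w; apply: continuous_comp; [exact: shift_continuous|exact: psi_continuous].
by move/continuous_closedP; apply.
Qed.

End Coding.

(** * Lower bound for the topological entropy *)

Lemma hausdorff_prod (X Y : topologicalType) :
  hausdorff_space X -> hausdorff_space Y -> hausdorff_space (X * Y)%type.
Proof.
rewrite !open_hausdorff => hX hY [x y] [x' y']; rewrite xpair_eqE negb_and.
case/orP=> [/hX|/hY] [[U V] /= [xU xV] [oU oV /eqP UV]].
- exists (fst @^-1` U, fst @^-1` V); first by rewrite !inE in xU xV *.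
  split; last by rewrite /= -preimage_setI UV preimage_set0.
  + by move: oU; apply: open_comp => p _; exact: cvg_fst.
  + by move: oV; apply: open_comp => p _; exact: cvg_fst.
- exists (snd @^-1` U, snd @^-1` V); first by rewrite !inE in xU xV *.
  split; last by rewrite /= -preimage_setI UV preimage_set0.
  + by move: oU; apply: open_comp => p _; exact: cvg_snd.
  + by move: oV; apply: open_comp => p _; exact: cvg_snd.
Qed.

(** * Counting reduced words and preimages under the shift *)

Section Counting.
Variable d : nat.
Implicit Types (s t : letter d).

Definition follows : rel (letter d) := fun s t => t != inv_letter s.

Lemma card_letter : #|{: letter d}| = (2 * d)%N.
Proof. by rewrite card_prod card_ord card_bool mulnC. Qed.

Lemma sum_follows t : (\sum_s follows t s = 2 * d - 1)%N.
Proof.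
rewrite -card_letter subn1 -(cardC1 (inv_letter t)) -sum1_card [RHS]big_mkcond.
by apply: eq_bigr => s _; rewrite inE /follows; case: (s != _).
Qed.

Lemma big_cons_tuple (V : nmodType) (T : finType) n (F : n.+1.-tuple T -> V) :
  \sum_v F v = \sum_s \sum_(v : n.-tuple T) F (cons_tuple s v).
Proof.
rewrite pair_bigA /= (reindex (fun p : T * n.-tuple T => cons_tuple p.1 p.2)) //=.
exists (fun v : n.+1.-tuple T => (thead v, [tuple of behead v])).
  by case=> s v _; congr (_, _) => //; apply: val_inj.
by move=> v _; rewrite [RHS]tuple_eta.
Qed.

Lemma count_paths t n :
  (\sum_(v : n.-tuple (letter d)) path follows t v = (2 * d - 1) ^ n)%N.
Proof.
elim: n t => [|n IH] t.
  by rewrite (big_pred1 [tuple]) //= => v; rewrite (tuple0 v) /= eqxx.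
rewrite (@big_cons_tuple nat) /= expnS -[X in (X * _)%N](sum_follows t) big_distrl /=.
apply: eq_bigr => s _; rewrite -(IH s) big_distrr /=.
by apply: eq_bigr => v _; rewrite mulnb.
Qed.

End Counting.

Section Preimages.
Variables (d : nat) (hd : (2 <= d)%N).
Implicit Types (s t : letter d).

Let base : letter d := (Ordinal hd, true).

(** The word [v] lists letters prepended one by one to the constant sequence [base]; it is therefore
    read backwards, with [base] as the default of [nth] for the tail. By [count_paths] this gives
    [(2 * d - 1) ^ n] preimages of one point under the [n]-th iterate of the shift. *)
Lemma preimage_word_subproof (v : seq (letter d)) : path (@follows d) base v ->
  forall k, nth base (rev v) k.+1 != inv_letter (nth base (rev v) k).
Proof.
move=> pv k; have [kv|kv] := leqP (size v) k.
  by rewrite !nth_default ?size_rev ?(leqW kv) // eq_sym inv_letter_neq.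
have : sorted (@follows d) (rcons (rev v) base).
  rewrite -rev_cons rev_sorted /=; rewrite (eq_path (e' := @follows d)) //.
  by move=> s t; rewrite /follows inv_letter_sym.
move/(sortedP base) => /(_ k).
rewrite size_rcons size_rev ltnS => /(_ kv).
have -> : nth base (rcons (rev v) base) k.+1 = nth base (rev v) k.+1.
  by rewrite nth_rcons size_rev; case: ltngtP => // h; rewrite nth_default // size_rev; lia.
by rewrite /follows nth_rcons size_rev kv.
Qed.

Definition preimage_word (v : seq (letter d)) (pv : path (@follows d) base v) :
  subshift hd := subshift_of hd (preimage_word_subproof pv).

Lemma preimage_word_inj n (u v : n.-tuple (letter d)) pu pv :
  @preimage_word u pu = @preimage_word v pv -> u = v.
Proof.
move=> uv; apply: val_inj; apply: (can_inj revK).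
apply: (@eq_from_nth _ base) => [|i _]; first by rewrite !size_rev !size_tuple.
exact: (congr1 (fun w => digit w i) uv).
Qed.

Lemma iter_shift_preimage_word n (u v : n.-tuple (letter d)) pu pv :
  iter n (@Defs.shift d hd) (@preimage_word u pu) =
  iter n (@Defs.shift d hd) (@preimage_word v pv).
Proof.
apply: subshiftP => i; rewrite !digit_iter_shift /digit /= !set_valE /=.
by rewrite !nth_default // size_rev size_tuple; lia.
Qed.

End Preimages.

Section TopologicalEntropy.
Variables (R : realType) (d : nat) (hd : (2 <= d)%N).
Variables (A : circle R -> circle R) (psi : subshift hd -> circle R).
Hypotheses (hA : is_bowen_series_map d A) (hpsi : is_cannon_thurston_map A psi).
Implicit Types (s t : letter d) (x y z : circle R) (w : subshift hd).

(** Injectivity of [A] on [U], tested only on codes that differ in the first digit and nowhere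
    else. *)
Definition separating (U : set (circle R)) := forall w w',
  digit w 0 != digit w' 0 -> Defs.shift w = Defs.shift w' -> U (psi w) -> ~ U (psi w').

(** Digits are recovered from the last of the [n] to the first: once the shifts agree, the
    separating set visited at time 0 decides the first digit. *)
Lemma separating_inj k (U : 'I_k -> set (circle R)) n w w' :
  (forall i, separating (U i)) ->
  iter n (@Defs.shift d hd) w = iter n (@Defs.shift d hd) w' ->
  (forall i, (i < n)%N ->
    exists j, U j (iter i A (psi w)) /\ U j (iter i A (psi w'))) ->
  w = w'.
Proof.
move=> sepU; elim: n w w' => [|n IH] w w' //.
rewrite !iterSr => ww' Uww'.
have sh : Defs.shift w = Defs.shift w'.
  apply: IH => // i ni.
  by rewrite !(psi_shift hpsi) -!iterSr; exact: Uww'.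
apply: subshiftP => -[|i]; last by rewrite -!digit_shift sh.
apply/eqP/negPn/negP => ww0.
by have [j [Uw Uw']] := Uww' 0%N isT; exact: (sepU j w w').
Qed.

(** Two of the [(2 * d - 1) ^ n] preimages of a point that lie in one cell of the join coincide, so
    a subcover needs a cell for each of them. *)
Lemma subcover_number_ge k (U : 'I_k -> set (circle R)) n :
  \bigcup_i U i = [set: circle R] -> (forall i, separating (U i)) ->
  ((2 * d - 1) ^ n <= subcover_number A U n)%N.
Proof.
move=> Ucov sepU.
pose P : {set n.-tuple (letter d)} :=
  [set v : n.-tuple (letter d) | path (@follows d) (Ordinal hd, true) v]%SET.
have cardP : #|P| = ((2 * d - 1) ^ n)%N.
  rewrite -(count_paths (Ordinal hd, true)) -sum1_card [LHS]big_mkcond /=.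
  by apply: eq_bigr => v _; rewrite inE; case: path.
have lb (S : {set {ffun 'I_n -> 'I_k}}) :
    (forall x, exists2 a, a \in S & join_cell A U a x) -> (#|P| <= #|S|)%N.
  move=> covS.
  have /choice[g hg] : forall v : n.-tuple (letter d), exists a : {ffun 'I_n -> 'I_k},
      forall pv : path (@follows d) (Ordinal hd, true) v,
      a \in S /\ join_cell A U a (psi (@preimage_word _ hd v pv)).
    move=> v; have [pv|npv] := pselect (path (@follows d) (Ordinal hd, true) v).
      have [a aS ja] := covS (psi (@preimage_word _ hd v pv)).
      by exists a => pv'; rewrite (bool_irrelevance pv' pv).
    have [a aS _] := covS point.
    by exists a => pv; case: (npv pv).
  rewrite -(card_in_imset (f := g)); last first.
    move=> u v; rewrite !inE => pu pv guv.
    have [_ ju] := hg u pu; have [_ jv] := hg v pv.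
    apply: (@preimage_word_inj _ hd _ u v pu pv).
    apply: (@separating_inj _ U n) => //; first exact: iter_shift_preimage_word.
    move=> i ni; exists (g u (Ordinal ni)); have := ju (Ordinal ni).
    by have := jv (Ordinal ni); rewrite -guv.
  by apply/subset_leq_card/fintype.subsetP => _ /imsetP[v + ->]; rewrite inE => pv; case: (hg v pv).
rewrite -cardP /subcover_number.
(* The default value of the minimum is the size of the whole join, which covers the circle too and
   obeys the same bound. *)
apply: (big_ind (fun m => #|P| <= m)%N).
- rewrite -cardsT; apply: lb => x.
  have /choice[a ha] : forall i : 'I_n, exists j, U j (iter i A x).
    move=> i; have : (\bigcup_i U i) (iter i A x) by rewrite Ucov.
    by move=> [j _ Uj]; exists j.
  by exists [ffun i => a i]; rewrite ?inE // => i; rewrite ffunE.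
- by move=> p q hp hq; rewrite leq_min hp.
- by move=> S /asboolP; exact: lb.
Qed.

Lemma digits_rel_open (k : nat) (r : letter d -> letter d -> Prop) :
  open [set p : subshift hd * subshift hd | r (digit p.1 k) (digit p.2 k)].
Proof.
rewrite openE => -[u v] /= ruv.
exists ([set w | digit w k = digit u k], [set w | digit w k = digit v k]).
  split; apply: open_nbhs_nbhs; split=> //.
    exact: (digit_open hd k [set digit u k]).
  exact: (digit_open hd k [set digit v k]).
by move=> [u' v'] /= [-> ->].
Qed.

Lemma digits_rel_closed (k : nat) (r : letter d -> letter d -> Prop) :
  closed [set p : subshift hd * subshift hd | r (digit p.1 k) (digit p.2 k)].
Proof. by rewrite -openC; exact: (@digits_rel_open k (fun s t => ~ r s t)). Qed.

(** Pairs of codes that differ exactly in the first digit form a compact set [K]. Its image in the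
    square of the circle is closed and misses the diagonal by [psi_neq], so some product
    neighbourhood of [(z, z)] avoids it. *)
Lemma separating_nbhs z : exists U : set (circle R), [/\ open U, U z & separating U].
Proof.
pose K := [set p : subshift hd * subshift hd | digit p.1 0 <> digit p.2 0] `&`
  \bigcap_k [set p : subshift hd * subshift hd | digit p.1 k.+1 = digit p.2 k.+1].
have cK : closed K.
  apply: closedI; first exact: (@digits_rel_closed 0 (fun s t => s <> t)).
  by apply: closed_bigI => k _; exact: (@digits_rel_closed k.+1 eq).
have cpK : compact K.
  have := compact_setX (@compact_subshift d hd) (@compact_subshift d hd).
  rewrite setXTT => cT; exact: (subclosed_compact cK cT).
pose f (p : subshift hd * subshift hd) := (psi p.1, psi p.2).
have cf : continuous f.
  move=> [w w'] S [[U V] /= [wU wV] UV].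
  exists (psi @^-1` U, psi @^-1` V); first by split; exact: (psi_continuous hpsi).
  by move=> [v v'] /= [Uv Vv']; exact: (UV (psi v, psi v')).
have cD : compact (f @` K).
  by apply: continuous_compact => //; exact: continuous_subspaceT.
have clD := compact_closed (hausdorff_prod (@hausdorff_circle R) (@hausdorff_circle R)) cD.
have : nbhs (z, z) (~` (f @` K)).
  apply: open_nbhs_nbhs; split; first by rewrite openC.
  move=> [[w w'] [/= ww' sh]] [wz w'z].
  have ww0 : digit w 0 != digit w' 0 by exact/eqP.
  have sh' : Defs.shift w = Defs.shift w' by apply: subshiftP => k; exact: sh.
  by apply: (psi_neq hA hpsi ww0 sh'); rewrite wz w'z.
case=> -[U V] /= [zU zV] UV.
exists (interior (U `&` V)); split; first exact: open_interior.
  exact: filterI.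
move=> w w' ww' sh /interior_subset[Uw _] /interior_subset[_ Vw'].
apply: (UV (psi w, psi w')) => //; exists (w, w') => //; split => /=; first exact/eqP.
by move=> k _ /=; rewrite -!digit_shift sh.
Qed.

Lemma separating_cover : exists k (U : 'I_k -> set (circle R)),
  [/\ forall i, open (U i), \bigcup_i U i = [set: circle R] & forall i, separating (U i)].
Proof.
have /choice[U hU] := separating_nbhs.
have : compact [set: circle R].
  have -> : [set: circle R] = psi @` [set: subshift hd].
    by apply/seteqP; split=> // z _; have [w <-] := psi_surj hpsi z; exists w.
  apply: continuous_compact; last exact: compact_subshift.
  exact: continuous_subspaceT (psi_continuous hpsi).
rewrite compact_cover => /(_ _ setT U); case.
- by move=> i _; have [] := hU i.
- by move=> z _; exists z => //; have [] := hU z.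
move=> D _ covD; pose s := finmap.enum_fset D.
exists (size s), (fun i : 'I_(size s) => U (nth point s i)); split.
- by move=> i; have [] := hU (nth point s i).
- apply/seteqP; split=> // z _; have [y /= yD Uyz] := covD z I.
  have ys : (index y s < size s)%N by rewrite index_mem.
  by exists (Ordinal ys) => //=; rewrite nth_index.
- by move=> i; have [] := hU (nth point s i).
Qed.

Lemma topological_entropy_ge :
  ((ln (2 * d - 1)%:R)%:E <= topological_entropy R A)%E.
Proof.
have [k [U [oU Ucov sepU]]] := separating_cover.
apply: (@le_trans _ _ (limn_esup (fun n => (ln (subcover_number A U n)%:R / n%:R)%:E : \bar R))).
  apply: le_ereal_inf_tmp => _ [V [N _ NV] <-].
  (* Every tail contains the index [N.+1], at which the division by [n] is genuine. *)
  apply: (@le_trans _ _ (ln (subcover_number A U N.+1)%:R / N.+1%:R)%:E); last first.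
    by apply: ereal_sup_ubound; exists N.+1 => //; apply: NV => /=.
  rewrite lee_fin ler_pdivlMr ?ltr0n // mulr_natr -lnXn ?ltr0n; last by lia.
  have sub := subcover_number_ge N.+1 Ucov sepU.
  have m0 : (0 < (2 * d - 1) ^ N.+1)%N by rewrite expn_gt0; lia.
  rewrite -natrX ler_ln ?posrE ?ltr0n ?ler_nat //.
  exact: leq_trans m0 sub.
by apply: ereal_sup_ubound; exists k, U.
Qed.

End TopologicalEntropy.

(** * Entropy of finite-valued functions *)

Section FiniteLaws.
Context (R : realType) (disp : measure_display) (T : measurableType disp).
Variable m : probability T R.

Definition finitely_measurable (F : finType) (U : T -> F) :=
  forall u, measurable (U @^-1` [set u]).

Definition law (F : finType) (U : T -> F) (u : F) : R := fine (m (U @^-1` [set u])).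

Definition mean (F : finType) (U : T -> F) (phi : F -> R) : R :=
  \sum_u law U u * phi u.

Definition entropy (F : finType) (U : T -> F) : R := - mean U (fun u => ln (law U u)).

Lemma law_ge0 (F : finType) (U : T -> F) u : 0 <= law U u.
Proof. by rewrite fine_ge0. Qed.

Lemma preimage_fin (F : finType) (U : T -> F) (D : pred F) :
  U @^-1` [set u | D u] = \bigcup_(u in [set` enum D]) (U @^-1` [set u]).
Proof.
apply/seteqP; split=> x /=; last by move=> [u /=]; rewrite mem_enum => Du ->.
by move=> Dx; exists (U x) => //=; rewrite mem_enum.
Qed.

Lemma measurable_preimage (F : finType) (U : T -> F) (D : pred F) :
  finitely_measurable U -> measurable (U @^-1` [set u | D u]).
Proof.
by move=> mU; rewrite preimage_fin; apply: fin_bigcup_measurable => // u _; exact: mU.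
Qed.

Lemma prob_preimage (F : finType) (U : T -> F) (D : pred F) : finitely_measurable U ->
  fine (m (U @^-1` [set u | D u])) = \sum_(u | D u) law U u.
Proof.
move=> mU; rewrite preimage_fin measure_fin_bigcup //=.
- rewrite -fsbig_seq ?enum_uniq // big_enum /= -sum_fine // => u _.
  by rewrite fin_num_measure.
- by move=> u v _ _ [x [/= <- <-]].
Qed.

Lemma finitely_measurable_comp (F G : finType) (U : T -> F) (h : F -> G) :
  finitely_measurable U -> finitely_measurable (h \o U).
Proof.
move=> mU v; rewrite (_ : _ @^-1` _ = U @^-1` [set u | h u == v]).
  exact: measurable_preimage.
by apply/seteqP; split=> x /= /eqP.
Qed.

Lemma finitely_measurable_pair (F G : finType) (U : T -> F) (V : T -> G) :
  finitely_measurable U -> finitely_measurable V ->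
  finitely_measurable (fun x => (U x, V x)).
Proof.
move=> mU mV [u v].
rewrite (_ : _ @^-1` _ = U @^-1` [set u] `&` V @^-1` [set v]); first exact: measurableI.
by apply/seteqP; split=> x /= [-> ->].
Qed.

Lemma law_comp (F G : finType) (U : T -> F) (h : F -> G) v : finitely_measurable U ->
  law (h \o U) v = \sum_(u | h u == v) law U u.
Proof.
move=> mU; rewrite -prob_preimage //; congr (fine (m _)).
by apply/seteqP; split=> x /= /eqP.
Qed.

Lemma law_sum (F : finType) (U : T -> F) : finitely_measurable U -> \sum_u law U u = 1.
Proof.
move=> mU; rewrite -prob_preimage // (_ : _ @^-1` _ = setT); last exact/seteqP.
by rewrite probability_setT.
Qed.

Lemma law_gt0 (F : finType) (U : T -> F) u : 0 < law U u -> exists x, U x = u.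
Proof.
move=> u0; apply: contrapT => /forallNP h; move: u0; rewrite /law.
by rewrite (_ : _ @^-1` _ = set0) ?measure0 ?ltxx // -subset0 => x /h.
Qed.

Lemma mean_comp (F G : finType) (U : T -> F) (h : F -> G) (phi : G -> R) :
  finitely_measurable U -> mean (h \o U) phi = mean U (phi \o h).
Proof.
move=> mU; rewrite /mean (partition_big h predT) //=; apply: eq_bigr => v _.
by rewrite law_comp // mulr_suml; apply: eq_bigr => u /eqP ->.
Qed.

(** Values that [U] does not take have law 0, so a comparison along the points of [T] is enough. *)
Lemma le_mean (F : finType) (U : T -> F) (phi psi : F -> R) :
  (forall x, phi (U x) <= psi (U x)) -> mean U phi <= mean U psi.
Proof.
move=> h; apply: ler_sum => u _; have := law_ge0 U u.
rewrite le_eqVlt => /orP[/eqP <-|u0]; first by rewrite !mul0r.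
by rewrite ler_pM2l //; have [x <-] := law_gt0 u0.
Qed.

Lemma eq_mean (F : finType) (U : T -> F) (phi psi : F -> R) :
  (forall x, phi (U x) = psi (U x)) -> mean U phi = mean U psi.
Proof. by move=> h; apply/eqP; rewrite eq_le !le_mean // => x; rewrite h. Qed.

Lemma mean_eq (F G : finType) (U : T -> F) (V : T -> G) (phi : F -> R) (psi : G -> R) :
  finitely_measurable U -> finitely_measurable V ->
  (forall x, phi (U x) = psi (V x)) -> mean U phi = mean V psi.
Proof.
move=> mU mV h; have mW := finitely_measurable_pair mU mV.
rewrite -[U]/(fst \o (fun x => (U x, V x))) -[V in RHS]/(snd \o (fun x => (U x, V x))).
by rewrite !mean_comp //; exact: eq_mean.
Qed.

Lemma meanD (F : finType) (U : T -> F) (phi psi : F -> R) :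
  mean U (fun u => phi u + psi u) = mean U phi + mean U psi.
Proof. by rewrite /mean -big_split; apply: eq_bigr => u _; rewrite mulrDr. Qed.

Lemma meanZ (F : finType) (U : T -> F) (phi : F -> R) a :
  mean U (fun u => a * phi u) = a * mean U phi.
Proof. by rewrite /mean mulr_sumr; apply: eq_bigr => u _; rewrite mulrCA. Qed.

Lemma mean_cst (F : finType) (U : T -> F) a : finitely_measurable U ->
  mean U (fun=> a) = a.
Proof. by move=> mU; rewrite /mean -mulr_suml law_sum // mul1r. Qed.

Lemma mean_indic (F : finType) (U : T -> F) (D : pred F) : finitely_measurable U ->
  mean U (fun u => (D u)%:R) = fine (m (U @^-1` [set u | D u])).
Proof.
move=> mU; rewrite prob_preimage // [RHS]big_mkcond; apply: eq_bigr => u _.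
by case: (D u); rewrite ?mulr1 ?mulr0.
Qed.

(** Merging values enlarges the atom around each point, and [- ln] is decreasing. *)
Lemma le_entropy_comp (F G : finType) (U : T -> F) (h : F -> G) :
  finitely_measurable U -> entropy (h \o U) <= entropy U.
Proof.
move=> mU; rewrite /entropy mean_comp // lerN2; apply: ler_sum => u _ /=.
have := law_ge0 U u; rewrite le_eqVlt => /orP[/eqP <-|u0]; first by rewrite !mul0r.
have uh : law U u <= law (h \o U) (h u).
  rewrite law_comp // (bigD1 u) //= lerDl; apply: sumr_ge0 => *; exact: law_ge0.
by rewrite ler_pM2l // ler_ln ?posrE // (lt_le_trans u0).
Qed.

(* Gibbs' inequality against the density [law U u * k u v]. *)
Lemma entropy_pair_le (F G : finType) (U : T -> F) (V : T -> G) (k : F -> G -> R) :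
  finitely_measurable U -> finitely_measurable V ->
  (forall u v, 0 <= k u v) -> (forall u, \sum_v k u v <= 1) ->
  (forall x, 0 < k (U x) (V x)) ->
  entropy (fun x => (V x, U x)) <=
  entropy U - mean (fun x => (V x, U x)) (fun w => ln (k w.2 w.1)).
Proof.
move=> mU mV k0 k1 kUV; set W := fun x => (V x, U x).
have mW : finitely_measurable W by exact: finitely_measurable_pair.
have -> : entropy U = - mean W (fun w => ln (law U w.2)).
  by rewrite /entropy; congr (- _); apply: mean_eq.
rewrite /entropy -opprD -meanD lerN2 -subr_ge0 /mean -sumrB.
have UW w : law W w <= law U w.2.
  rewrite -[U]/(snd \o W) law_comp // (bigD1 w) //= lerDl.
  by apply: sumr_ge0 => *; exact: law_ge0.
(* The subtracted weights have total at most 1 while the law has total 1, so this sum is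
   nonnegative; it remains to compare termwise. *)
apply: (@le_trans _ _ (\sum_w (law W w - law U w.2 * k w.2 w.1))).
  rewrite sumrB law_sum // subr_ge0 -(pair_bigA _ (fun v u => law U u * k u v)) /=.
  rewrite exchange_big /= -(law_sum mU); apply: ler_sum => u _.
  by rewrite -mulr_sumr ler_piMr ?law_ge0.
apply: ler_sum => -[v u] _ /=.
have := law_ge0 W (v, u); rewrite le_eqVlt => /orP[/eqP <-|p0].
  by rewrite !mul0r subrr sub0r oppr_le0 mulr_ge0 ?law_ge0.
have [x [xv xu]] := law_gt0 p0.
have q0 : 0 < law U u by apply: lt_le_trans p0 (UW (v, u)).
have kuv : 0 < k u v by rewrite -xv -xu.
rewrite -mulrBr -lnM ?posrE // -ler_pdivrMl // mulrBr mulVf ?gt_eqF //.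
set p := law W (v, u); set qk := _ * k u v.
have qk0 : 0 < qk by rewrite mulr_gt0.
(* The tangent inequality for the logarithm at 1, in the ratio of predicted to actual mass. *)
have : ln (qk / p) <= qk / p - 1.
  rewrite -[X in ln X](subrK 1) addrC; apply: le_ln1Dx.
  by rewrite ltrBrDr addNr divr_gt0.
rewrite ln_div ?posrE // mulrC; lra.
Qed.

End FiniteLaws.

(** * Entropy of a process predicted from its future labels *)

Section Process.
Context (R : realType) (disp : measure_display) (T : measurableType disp).
Variables (m : probability T R) (f : T -> T).
Hypothesis mf : measurable_fun setT f.
Hypothesis inv : forall B, measurable B -> m (f @^-1` B) = m B.

Lemma measurable_preimageT B : measurable B -> measurable (f @^-1` B).
Proof. by move=> mB; rewrite -[_ @^-1` _]setTI; exact: mf. Qed.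

Lemma finitely_measurable_step (F : finType) (U : T -> F) :
  finitely_measurable U -> finitely_measurable (U \o f).
Proof. by move=> mU u; apply: (@measurable_preimageT (U @^-1` [set u])). Qed.

Lemma law_step (F : finType) (U : T -> F) : finitely_measurable U ->
  law m (U \o f) = law m U.
Proof. by move=> mU; apply/funext => u; rewrite /law comp_preimage inv. Qed.

Variables (E : finType) (y : T -> E).
Hypothesis my : finitely_measurable y.

Lemma size_word N x : size (map y (traject f x N)) == N.
Proof. by rewrite size_map size_traject. Qed.

Definition word N x : N.-tuple E := Tuple (size_word N x).

Lemma wordS N x : word N.+1 x = cons_tuple (y x) (word N (f x)).
Proof. exact: val_inj. Qed.

Lemma belast_word N x : word N x = belast (y x) (word N (f x)) :> seq E.
Proof.
have /rcons_inj[] : rcons (belast (y x) (word N (f x))) (last (y x) (word N (f x))) =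
    rcons (word N x) (y (iter N f x)).
  by rewrite -lastI /= -map_rcons -trajectSr.
by move=> ->.
Qed.

Lemma nth_word e N x i : (i < N)%N -> nth e (word N x) i = y (iter i f x).
Proof.
by move=> iN; rewrite (nth_map x) ?size_traject // nth_traject.
Qed.

Lemma finitely_measurable_word N : finitely_measurable (word N).
Proof.
elim: N => [|N IH] u.
  rewrite (_ : _ @^-1` _ = setT) //; apply/seteqP; split=> x //= _.
  by rewrite (tuple0 u) tuple0.
move: u; rewrite -/(finitely_measurable _).
have -> : word N.+1 = (fun p : E * N.-tuple E => cons_tuple p.1 p.2) \o
    (fun x => (y x, word N (f x))) by apply/funext => x; exact: wordS.
apply: finitely_measurable_comp; apply: finitely_measurable_pair => //.
exact: finitely_measurable_step.
Qed.

Variables (k : nat) (q : T -> 'I_k) (N : nat).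
Hypothesis mq : finitely_measurable q.

(** Range of [history]: [n] successive pairs of a value of [q] and a label, closed by a word of [N]
    labels, so that at each of the [n] times the next [N] labels can be read off. *)
Fixpoint block n : finType :=
  if n is n'.+1 then ('I_k * E * block n')%type else N.-tuple E.

Fixpoint history n : T -> block n :=
  if n is n'.+1 then fun x => ((q x, y x), history n' (f x)) else word N.

(** The first [N] labels, obtained by prepending one label at a time and dropping the last; cf.
    [belast_word]. *)
Fixpoint front n : block n -> N.-tuple E :=
  if n is n'.+1 then fun b => [tuple of belast b.1.2 (front b.2)] else id.

Fixpoint labels n : block n -> seq 'I_k :=
  if n is n'.+1 then fun b => b.1.1 :: labels b.2 else fun=> [::].

Lemma front_history n x : front (history n x) = word N x.
Proof.
elim: n x => //= n IH x; apply: val_inj.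
rewrite [LHS]/= IH; exact: esym (belast_word N x).
Qed.

Lemma labels_history n x : labels (history n x) = map q (traject f x n).
Proof. by elim: n x => //= n IH x; rewrite IH. Qed.

Lemma finitely_measurable_history n : finitely_measurable (history n).
Proof.
elim: n => [|n IH]; first exact: finitely_measurable_word.
apply: finitely_measurable_pair; first exact: finitely_measurable_pair.
exact: (finitely_measurable_step IH).
Qed.

Variable kappa : N.-tuple E -> 'I_k * E -> R.
Hypothesis kappa_ge0 : forall w v, 0 <= kappa w v.
Hypothesis kappa_sum : forall w, \sum_v kappa w v <= 1.
Hypothesis kappa_gt0 : forall x, 0 < kappa (word N (f x)) (q x, y x).

(** [history 1] holds exactly the pair at a point and the [N] labels that follow, which are the
    arguments of the kernel. *)
Definition cost := - mean m (history 1) (fun b => ln (kappa b.2 b.1)).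

(** By invariance the history from time 1 on has the entropy of a history of length [n]; by Gibbs'
    inequality the pair at time 0 adds at most [cost]. *)
Lemma entropy_history n :
  entropy m (history n) <= entropy m (word N) + n%:R * cost.
Proof.
elim: n => [|n IH]; first by rewrite mul0r addr0.
have mh := @finitely_measurable_history n.
have mqy : finitely_measurable (fun x => (q x, y x)) by exact: finitely_measurable_pair.
apply: le_trans
  (entropy_pair_le m (U := history n \o f) (V := fun x => (q x, y x))
    (k := fun b v => kappa (front b) v) _ _ _ _ _) _ => //.
- exact: finitely_measurable_step.
- by move=> x /=; rewrite front_history.
- have -> : entropy m (history n \o f) = entropy m (history n).
    by rewrite /entropy /mean law_step.
  rewrite -natr1 mulrDl mul1r addrA lerD // /cost lerN2 le_eqVlt; apply/orP; left.
  apply/eqP; apply: mean_eq.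
  + exact: (@finitely_measurable_history 1).
  + exact: (@finitely_measurable_history n.+1).
  + by move=> x /=; rewrite front_history.
Qed.

Lemma history_entropy_ge n : (0 < k)%N ->
  entropy m (fun x => [ffun i : 'I_n => q (iter i f x)]) <= entropy m (history n).
Proof.
move=> k0.
have -> : (fun x => [ffun i : 'I_n => q (iter i f x)]) =
    (fun b => [ffun i : 'I_n => nth (Ordinal k0) (labels b) i]) \o history n.
  apply/funext => x; apply/ffunP => i; rewrite !ffunE labels_history.
  by rewrite (nth_map x) ?size_traject // nth_traject.
apply: le_entropy_comp; exact: finitely_measurable_history.
Qed.

(** The history determines the labels of the join and has entropy at most [h0 + n * cost], with [h0]
    independent of [n]; after division by [n] the term [h0] disappears. *)
Lemma limn_entropy_le (P : 'I_k -> set T) :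
  (forall i x, P i x <-> q x = i) ->
  (limn_esup (fun n => (join_entropy m f P n / n%:R)%:E) <= cost%:E)%E.
Proof.
move=> Pq; have k0 : (0 < k)%N by apply: leq_ltn_trans (ltn_ord (q point)).
have joinE n : join_entropy m f P n = entropy m (fun x => [ffun i : 'I_n => q (iter i f x)]).
  rewrite /join_entropy /entropy /mean /law; congr (- _); apply: eq_bigr => a _.
  suff -> : join_cell f P a = (fun x => [ffun i : 'I_n => q (iter i f x)]) @^-1` [set a] by [].
  apply/seteqP; split=> x /=.
    by move=> xa; apply/ffunP => i; rewrite ffunE; apply/Pq; exact: xa.
  by move=> <- i; apply/Pq; rewrite ffunE.
apply/lee_addgt0Pr => e e0.
set h0 := entropy m (word N).
have [n0 hn0] : exists n0, forall n, (n0 <= n)%N -> (0 < n)%N /\ h0 / n%:R <= e.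
  exists (Num.truncn (`|h0| / e)).+1 => n hn.
  have n0 : (0 < n)%N by apply: leq_trans hn.
  split=> //; rewrite ler_pdivrMr ?ltr0n // (le_trans (ler_norm _)) //.
  rewrite mulrC -ler_pdivrMr // ltW // (lt_le_trans (truncnS_gt _)) // ler_nat //.
apply: ge_ereal_inf; exists (ereal_sup ((fun n => (join_entropy m f P n / n%:R)%:E) @` [set n | (n0 <= n)%N])).
  by exists [set n | (n0 <= n)%N] => //; exists n0.
apply: ge_ereal_sup => _ [n /= /hn0[n_gt0 hn] <-].
rewrite -EFinD lee_fin joinE.
have := le_trans (history_entropy_ge n k0) (entropy_history n); rewrite -/h0 => h.
rewrite ler_pdivrMr ?ltr0n // (le_trans h) // mulrDl addrC mulrC lerD2l.
by rewrite -ler_pdivrMr // ltr0n.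
Qed.

End Process.

(** Bounding [ln] of the reciprocal gives [u / (1 + u) <= ln (1 + u)]. The comparison with the
    quadratic reduces to [0 <= u ^+ 2 * (1 + 2 * u)], hence the range of [u]. *)
Lemma ln1D_ge (R : realType) (u : R) : - 2^-1 <= u -> u - 2 * u ^+ 2 <= ln (1 + u).
Proof.
move=> hu; have u1 : 0 < 1 + u by lra.
have h : ln (1 + - (u / (1 + u))) <= - (u / (1 + u)).
  apply: le_ln1Dx; rewrite ltrN2 ltr_pdivrMr //; lra.
have e : 1 + - (u / (1 + u)) = (1 + u)^-1 by field; apply/eqP; lra.
rewrite e lnV ?posrE // in h.
have : u / (1 + u) <= ln (1 + u) by lra.
apply: le_trans; rewrite ler_pdivlMr //.
rewrite -subr_ge0.
have -> : u - (u - 2 * u ^+ 2) * (1 + u) = u ^+ 2 * (1 + 2 * u) by ring.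
rewrite mulr_ge0 ?sqr_ge0 //; lra.
Qed.

(** * Entropy bounds from kernels on the labels alone *)

Section Approximation.
Context (R : realType) (disp : measure_display) (T : measurableType disp).
Variables (m : probability T R) (f : T -> T).
Hypothesis mf : measurable_fun setT f.
Hypothesis inv : forall B, measurable B -> m (f @^-1` B) = m B.
Variables (E : finType) (y : T -> E).
Hypothesis my : finitely_measurable y.

(** A finite union of cylinders in the usual sense. The predicate lives on plain sequences so that
    it applies to truncated words, as in [cylinder_widen]. *)
Definition cylinder N (D : pred (seq E)) : set T := [set x | D (word f y N x)].

Lemma measurable_cylinder N D : measurable (cylinder N D).
Proof.
by apply: (measurable_preimage (fun w : N.-tuple E => D w)); exact: finitely_measurable_word.
Qed.

Lemma take_word M N x : (M <= N)%N -> take M (word f y N x) = word f y M x.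
Proof.
move=> MN /=; rewrite -map_take; congr map.
apply: (@eq_from_nth _ x) => [|i]; rewrite size_take_min !size_traject; first lia.
move=> iM; have [iM' iN] : (i < M)%N /\ (i < N)%N by lia.
by rewrite nth_take // !nth_traject.
Qed.

Lemma cylinder_widen M N D : (M <= N)%N ->
  cylinder M D = cylinder N (fun w => D (take M w)).
Proof. by move=> MN; apply/seteqP; split=> x; rewrite /cylinder /= -(take_word _ MN). Qed.

(** The form in which it is used that the labels generate the sigma-algebra modulo [m]. *)
Definition approximable (B : set T) := forall e : R, 0 < e -> exists N D,
  (m ((B `\` cylinder N D) `|` (cylinder N D `\` B)) <= e%:E)%E.

Hypothesis approx : forall B, measurable B -> approximable B.

(** Approximate each fibre of [q] by a cylinder up to [e / k] and guess a value whose cylinder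
    contains the point. A wrong guess puts the point into one of the [k] symmetric differences. *)
Lemma approximable_fun k (q : T -> 'I_k) (e : R) : finitely_measurable q -> 0 < e ->
  exists N (G : seq E -> 'I_k),
    fine (m ((fun x => (q x, word f y N x)) @^-1` [set p : 'I_k * N.-tuple E | p.1 != G p.2])) <= e.
Proof.
move=> mq e0; have k0 : (0 < k)%N by apply: leq_ltn_trans (ltn_ord (q point)).
have ek : 0 < e / k%:R by rewrite divr_gt0 // ltr0n.
have /choice[N hN] : forall i : 'I_k, exists N, exists D,
    (m ((q @^-1` [set i] `\` cylinder N D) `|` (cylinder N D `\` q @^-1` [set i])) <= (e / k%:R)%:E)%E.
  by move=> i; apply: approx => //; exact: mq.
have /choice[D hD] := hN.
pose M := \max_i N i.
have NM i : (N i <= M)%N by exact: leq_bigmax.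
(* If no cylinder contains the point, the default guess is harmless: the point is then missed by the
   cylinder of its own value. *)
pose G (w : seq E) := odflt (Ordinal k0) [pick i | D i (take (N i) w)].
have GP x : cylinder (N (G (word f y M x))) (D (G (word f y M x))) x \/
    forall i, ~ cylinder (N i) (D i) x.
  rewrite /G; case: pickP => [i Di|nD] /=; [left|right=> i].
    by rewrite /cylinder /= -(take_word _ (NM i)).
  by rewrite /cylinder /= -(take_word _ (NM i)) nD.
exists M, G.
set S := _ @^-1` _.
have mS : measurable S.
  apply: (measurable_preimage (fun p : 'I_k * M.-tuple E => p.1 != G p.2)).
  by apply: finitely_measurable_pair => //; exact: finitely_measurable_word.
rewrite -lee_fin fineK ?fin_num_measure //.
pose B i := (q @^-1` [set i] `\` cylinder (N i) (D i)) `|` (cylinder (N i) (D i) `\` q @^-1` [set i]).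
have mB i : measurable (B i).
  by apply: measurableU; apply: measurableD; (exact: mq || exact: measurable_cylinder).
apply: (@le_trans _ _ (\sum_(i < k) m (B i))%E).
  rewrite -big_enum fsbig_seq ?enum_uniq //=.
  apply: content_sub_fsum => // x /=.
  move=> /eqP qG; have [GD|nD] := GP x.
    exists (G (word f y M x)); first by rewrite /= mem_enum.
    by right; split=> //= /esym.
  by exists (q x); [rewrite /= mem_enum|left; split => //; exact: nD].
apply: (@le_trans _ _ (\sum_(i < k) (e / k%:R)%:E)%E); first by apply: lee_sum => i _; exact: hD.
by rewrite sumEFin lee_fin sumr_const card_ord -[(e / _) *+ _]mulr_natr divfK // pnatr_eq0; lia.
Qed.

Definition transition M x : E * M.-tuple E := (y x, word f y M (f x)).

Lemma finitely_measurable_transition M : finitely_measurable (transition M).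
Proof.
apply: finitely_measurable_pair => //.
by apply: (finitely_measurable_step mf); exact: finitely_measurable_word.
Qed.

(* The kernel of the Gibbs estimate codes q by the guess G with error
   probability dl, and the letter y by g. *)
Lemma limn_entropy_kernel_le M (g : M.-tuple E -> E -> R) k (q : T -> 'I_k) (P : 'I_k -> set T) :
  (forall w s, 0 <= g w s) -> (forall w, \sum_s g w s <= 1) ->
  (forall x, 0 < g (word f y M (f x)) (y x)) ->
  finitely_measurable q -> (forall i x, P i x <-> q x = i) ->
  (limn_esup (fun n => (join_entropy m f P n / n%:R)%:E) <=
   (- mean m (transition M) (fun p => ln (g p.2 p.1)))%:E)%E.
Proof.
move=> g0 g1 gpos mq Pq; have k0 : (0 < k)%N by apply: leq_ltn_trans (ltn_ord (q point)).
have kR : 1 <= k%:R :> R by rewrite ler1n.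
apply/lee_addgt0Pr => e e0.
(* Chosen so that a correct guess costs exactly [e / 2]. A wrong one costs [L], so the probability
   of error is made at most [e / 2 / L]. *)
pose dl := 1 - expR (- (e / 2)).
have ex0 : 0 < expR (- (e / 2)) := expR_gt0 _.
have dl1 : dl < 1 by rewrite /dl; lra.
have dl0 : 0 < dl by rewrite /dl subr_gt0 expR_lt1; lra.
have lndl : ln (1 - dl) = - (e / 2) by rewrite /dl opprB addrC subrK expRK.
pose L := ln (k%:R / dl).
have kdl : 1 < k%:R / dl by rewrite ltr_pdivlMr // mul1r; lra.
have L0 : 0 < L by exact: ln_gt0.
have [N0 [G hG]] := approximable_fun mq (divr_gt0 (divr_gt0 e0 (ltr0Sn R 1)) L0).
pose N := maxn N0 M.
pose trunc (w : N.-tuple E) : M.-tuple E := [tuple nth (y point) w i | i < M].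
have truncE x : trunc (word f y N x) = word f y M x.
  apply: eq_from_tnth => i; rewrite tnth_mktuple (tnth_nth (y point)).
  by rewrite !nth_word //; have := ltn_ord i; rewrite /N; lia.
pose c (i : 'I_k) (u : seq E) : R := if i == G u then 1 - dl else dl / k%:R.
have dk0 : 0 < dl / k%:R by rewrite divr_gt0 //; lra.
have c0 i u : 0 < c i u by rewrite /c; case: ifP => _ //; lra.
have c1 u : \sum_i c i u <= 1.
  apply: (@le_trans _ _ (\sum_i ((if i == G u then 1 - dl else 0) + dl / k%:R))).
    by apply: ler_sum => i _; rewrite /c; case: ifP; rewrite ?lerDl ?add0r // ltW.
  rewrite big_split /= -big_mkcond big_pred1_eq sumr_const card_ord.
  by rewrite -[(dl / _) *+ _]mulr_natr divfK ?subrK // gt_eqF //; lra.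
(* The label is predicted first, by [g]; the guess of [q] may then use it, so it reads the word
   [v.2 :: w] that starts at the point itself. *)
pose kappa (w : N.-tuple E) (v : 'I_k * E) := c v.1 (take N0 (v.2 :: w)) * g (trunc w) v.2.
have wordN0 x : take N0 (y x :: word f y N (f x)) = word f y N0 x.
  rewrite -[y x :: _]/(tval (cons_tuple (y x) (word f y N (f x)))) -wordS take_word //.
  by rewrite /N; lia.
have kap0 w v : 0 <= kappa w v by rewrite mulr_ge0 // ltW.
have kap1 w : \sum_v kappa w v <= 1.
  rewrite -(pair_bigA _ (fun i s => kappa w (i, s))) exchange_big /=.
  apply: le_trans (g1 (trunc w)); apply: ler_sum => s _.
  by rewrite /kappa /= -mulr_suml ler_piMl.
have kap2 x : 0 < kappa (word f y N (f x)) (q x, y x).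
  by rewrite /kappa /= mulr_gt0 // truncE.
apply: (le_trans (limn_entropy_le mf inv my mq kap0 kap1 kap2 Pq)).
rewrite -EFinD lee_fin /cost.
have mh := finitely_measurable_history mf my mq (N := N) (n := 1).
have -> : mean m (history f y q N 1) (fun b => ln (kappa b.2 b.1)) =
    mean m (history f y q N 1) (fun b => ln (c b.1.1 (take N0 (b.1.2 :: b.2)))) +
    mean m (transition M) (fun p => ln (g p.2 p.1)).
  have -> : mean m (transition M) (fun p => ln (g p.2 p.1)) =
      mean m (history f y q N 1) (fun b => ln (g (trunc b.2) b.1.2)).
    apply: mean_eq => //; first exact: finitely_measurable_transition.
    by move=> x /=; rewrite truncE.
  rewrite -meanD; apply: eq_mean => x /=.
  by rewrite /kappa lnM ?posrE //= truncE.
rewrite opprD [X in _ <= X]addrC lerD2r -mulN1r -meanZ.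
set W := fun x => (q x, word f y N0 x) in hG.
have mW : finitely_measurable W.
  by apply: finitely_measurable_pair => //; exact: finitely_measurable_word.
apply: (@le_trans _ _ (mean m W (fun p : 'I_k * N0.-tuple E => e / 2 + L * (p.1 != G p.2)%:R))).
  have -> : mean m (history f y q N 1) (fun b => -1 * ln (c b.1.1 (take N0 (b.1.2 :: b.2)))) =
      mean m W (fun p : 'I_k * N0.-tuple E => - ln (c p.1 p.2)).
    by apply: mean_eq => // x /=; rewrite wordN0 mulN1r.
  apply: le_mean => x /=; rewrite /c; case: eqP => _ /=.
    by rewrite lndl; lra.
  rewrite -lnV ?posrE // invf_div mulr1 lerDr; lra.
rewrite meanD mean_cst // meanZ (mean_indic _ (fun p : 'I_k * N0.-tuple E => p.1 != G p.2)) //.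
have : L * fine (m (W @^-1` [set p : 'I_k * N0.-tuple E | p.1 != G p.2])) <= L * (e / 2 / L).
  by rewrite ler_pM2l.
rewrite [L * (_ / L)]mulrC divfK ?gt_eqF //; lra.
Qed.

Lemma measure_entropy_kernel_le M (g : M.-tuple E -> E -> R) :
  (forall w s, 0 <= g w s) -> (forall w, \sum_s g w s <= 1) ->
  (forall x, 0 < g (word f y M (f x)) (y x)) ->
  (measure_entropy m f <= (- mean m (transition M) (fun p => ln (g p.2 p.1)))%:E)%E.
Proof.
move=> g0 g1 gpos; apply: ge_ereal_sup => _ [k [P [mP tP cP ->]]].
have /choice[q hq] : forall x, exists i, P i x.
  move=> x; have : (\bigcup_i P i) x by rewrite cP.
  by move=> [i _ Pi]; exists i.
have Pq i x : P i x <-> q x = i.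
  split=> [Pix|<-]; last exact: hq.
  by apply: tP => //; exists x; split; [exact: hq|].
apply: (@limn_entropy_kernel_le M g k q P) => //.
move=> i; rewrite (_ : _ @^-1` _ = P i) //.
by apply/seteqP; split=> x /= /Pq.
Qed.

Variables (M n : nat) (allowed : M.-tuple E -> pred E).
Hypothesis n_gt0 : (0 < n)%N.
Hypothesis card_allowed : forall w, #|allowed w| = n.
Hypothesis allowedP : forall x, allowed (word f y M (f x)) (y x).
Hypothesis entropy_ge : ((ln n%:R)%:E <= measure_entropy m f)%E.

(* To first order, tilting the uniform kernel by phi changes the bound of
   [measure_entropy_kernel_le] by the mean of phi. *)
Lemma mean_perturbation_le0 (phi : M.-tuple E -> E -> R) :
  (forall w s, `|phi w s| <= 1) -> (forall w, \sum_(s | allowed w s) phi w s = 0) ->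
  mean m (transition M) (fun p => phi p.2 p.1) <= 0.
Proof.
move=> phi1 phi0; have nR : 0 < n%:R :> R by rewrite ltr0n.
have mZ := finitely_measurable_transition (M := M).
set mu := mean _ _ _.
suff h t : 0 < t -> t <= 2^-1 -> mu <= 2 * t.
  rewrite leNgt; apply/negP => mu0.
  (* For positive [mu] this choice of [t] would give [mu <= mu / 2]. *)
  have := h (Num.min 2^-1 (mu / 4)); rewrite lt_min ge_min lexx invr_gt0 ltr0n /=.
  rewrite divr_gt0 // => /(_ isT isT) h'.
  have : 2 * Num.min 2^-1 (mu / 4) <= 2 * (mu / 4) by rewrite ler_pM2l // ge_min lexx orbT.
  lra.
move=> t0 t1.
have tphi w s : - 2^-1 <= t * phi w s.
  have : - 1 <= phi w s by move: (phi1 w s); rewrite ler_norml => /andP[].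
  move=> h; have : t * -1 <= t * phi w s by rewrite ler_pM2l.
  lra.
(* The tilted kernel still has total mass 1, because [phi] sums to zero over the allowed letters,
   and the bound on [t] keeps it positive there. *)
pose g w s : R := if allowed w s then (1 + t * phi w s) / n%:R else 0.
have g0 w s : 0 <= g w s.
  by rewrite /g; case: ifP => // _; rewrite divr_ge0 ?ltW //; have := tphi w s; lra.
have g1 w : \sum_s g w s <= 1.
  rewrite -big_mkcond -mulr_suml big_split /= -mulr_sumr phi0 mulr0 addr0.
  by rewrite sumr_const card_allowed divff // gt_eqF.
have g2 x : 0 < g (word f y M (f x)) (y x).
  rewrite /g allowedP divr_gt0 //.
  by have := tphi (word f y M (f x)) (y x); lra.
have := le_trans entropy_ge (measure_entropy_kernel_le g0 g1 g2).
rewrite lee_fin => h.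
have e1 : mean m (transition M) (fun p => ln (g p.2 p.1)) =
    mean m (transition M) (fun p => ln (1 + t * phi p.2 p.1)) - ln n%:R.
  rewrite -[X in _ - X](mean_cst m (ln n%:R) mZ) -mulN1r -meanZ -meanD.
  apply: eq_mean => x /=; rewrite /g allowedP ln_div ?posrE ?mulN1r //.
  by have := tphi (word f y M (f x)) (y x); lra.
(* The error is of second order in [t], while the entropy hypothesis makes the right-hand side
   nonpositive. *)
have e2 : t * mu - 2 * t ^+ 2 <= mean m (transition M) (fun p => ln (1 + t * phi p.2 p.1)).
  rewrite -meanZ -[X in _ - X](mean_cst m (2 * t ^+ 2) mZ) -mulN1r -meanZ -meanD.
  apply: le_mean => x /=; rewrite mulN1r.
  apply: le_trans (ln1D_ge (tphi _ _)); rewrite lerD2l lerN2 ler_pM2l // exprMn.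
  rewrite ler_piMr ?sqr_ge0 // -real_normK ?num_real // expr_le1 //.
have : t * mu <= t * (2 * t) by move: e2; rewrite expr2; lra.
by rewrite ler_pM2l.
Qed.

(** The perturbation is the difference of the indicators of [s1] and [s2] after [w], which sums to
    zero over the allowed letters; exchanging the letters gives the other inequality. *)
Lemma law_transition_eq w s1 s2 : allowed w s1 -> allowed w s2 ->
  law m (transition M) (s1, w) = law m (transition M) (s2, w).
Proof.
wlog suff h : s1 s2 / allowed w s1 -> allowed w s2 ->
    law m (transition M) (s1, w) <= law m (transition M) (s2, w).
  by move=> a1 a2; apply/eqP; rewrite eq_le !h.
move=> a1 a2; have [->//|s12] := eqVneq s1 s2.
pose phi (u : M.-tuple E) s : R :=
  (u == w)%:R * ((s == s1)%:R - (s == s2)%:R).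
have /mean_perturbation_le0 : forall u s, `|phi u s| <= 1.
  move=> u s; rewrite /phi; case: (u == w); last by rewrite mul0r normr0.
  rewrite mul1r; case: eqP => [->|_]; first by rewrite (negPf s12) subr0 normr1.
  by case: eqP; rewrite ?subr0 ?normr0 // sub0r normrN1.
have -> : mean m (transition M) (fun p => phi p.2 p.1) =
    law m (transition M) (s1, w) - law m (transition M) (s2, w).
  rewrite /mean (bigD1 (s1, w)) //= (bigD1 (s2, w)) /=; last by rewrite xpair_eqE eq_sym (negPf s12).
  rewrite big1 => [|[s u] /= /andP[n1 n2]].
    by rewrite addr0 /phi !eqxx /= (negPf s12) eq_sym (negPf s12) !mul1r sub0r subr0 mulr1 mulrN1.
  move: n1 n2; rewrite /phi !xpair_eqE; case: (u == w); last by rewrite mul0r mulr0.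
  by rewrite !andbT => /negPf -> /negPf ->; rewrite subrr !mulr0.
have sum1 s : allowed w s -> \sum_(r | allowed w r) (r == s)%:R = 1 :> R.
  by move=> ws; rewrite (bigD1 s) //= eqxx big1 ?addr0 // => r /andP[_ /negPf ->].
rewrite subr_le0; apply=> u; rewrite /phi -mulr_sumr; have [->|_] := eqVneq u w.
  by rewrite sumrB !sum1 // subrr mulr0.
by rewrite mul0r.
Qed.

End Approximation.

(** * Approximation of measurable sets by label cylinders *)

Section Approximable.
Context (R : realType) (disp : measure_display) (T : measurableType disp).
Variables (m : probability T R) (f : T -> T).
Hypothesis mf : measurable_fun setT f.
Variables (E : finType) (y : T -> E).
Hypothesis my : finitely_measurable y.
Local Notation cylinder := (cylinder f y).
Local Notation approximable := (approximable m f y).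

Let mcyl N D : measurable (cylinder N D) := measurable_cylinder mf my N D.

Let msym B N D : measurable B ->
  measurable ((B `\` cylinder N D) `|` (cylinder N D `\` B)).
Proof. by move=> mB; apply: measurableU; apply: measurableD. Qed.

Lemma approximable_cylinder N D : approximable (cylinder N D).
Proof. by move=> e e0; exists N, D; rewrite setDv setU0 measure0 lee_fin ltW. Qed.

Lemma approximableC B : approximable B -> approximable (~` B).
Proof.
move=> aB e /aB[N [D hD]]; exists N, (fun w => ~~ D w).
apply: le_trans hD; rewrite le_eqVlt; apply/orP; left; apply/eqP; congr (m _).
have -> : cylinder N (fun w => ~~ D w) = ~` cylinder N D.
  by apply/seteqP; split=> x /=; rewrite /cylinder /= => /negP.
by rewrite !setDE !setCK setUC [~` B `&` _]setIC [~` _ `&` B]setIC.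
Qed.

Lemma approximableU B C : measurable B -> measurable C ->
  approximable B -> approximable C -> approximable (B `|` C).
Proof.
move=> mB mC aB aC e e0; have e2 : 0 < e / 2 by lra.
have [N [D hD]] := aB _ e2; have [N' [D' hD']] := aC _ e2.
rewrite (cylinder_widen _ _ _ (leq_maxl N N')) in hD.
rewrite (cylinder_widen _ _ _ (leq_maxr N N')) in hD'.
set M := maxn N N' in hD hD'; set D1 := (fun w => D _) in hD; set D2 := (fun w => D' _) in hD'.
exists M, (fun w => D1 w || D2 w).
have -> : cylinder M (fun w => D1 w || D2 w) = cylinder M D1 `|` cylinder M D2.
  by apply/seteqP; split=> x; rewrite /cylinder /= => /orP.
have e_split : (e%:E = (e / 2)%:E + (e / 2)%:E)%E by rewrite -EFinD -splitr.
rewrite e_split; apply: le_trans (leeD hD hD').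
apply: le_trans (measureU2 m (@msym B M D1 mB) (@msym C M D2 mC)).
apply: le_measure; rewrite ?inE.
- apply: measurableU; apply: measurableD; apply: measurableU => //; exact: mcyl.
- by apply: measurableU; exact: msym.
- move=> x; move=> [[[Bx|Cx] /not_orP[n1 n2]]|[[Dx|Dx] /not_orP[n1 n2]]].
  + by left; left.
  + by right; left.
  + by left; right.
  + by right; right.
Qed.

(** A finite partial union already has all but [e / 2] of the mass, by continuity from above; the
    other half of [e] is spent on approximating it. *)
Lemma approximable_bigcup (B : nat -> set T) : (forall n, measurable (B n)) ->
  (forall n, approximable (B n)) -> approximable (\bigcup_n B n).
Proof.
move=> mB aB e e0; have e2 : 0 < e / 2 by lra.
pose U n := \big[setU/set0]_(i < n) B i.
have mU n : measurable (U n) by apply: bigsetU_measurable.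
have aU n : approximable (U n).
  elim: n => [|n IH].
    rewrite /U big_ord0 (_ : set0 = cylinder 0 (fun=> false)); first exact: approximable_cylinder.
    by apply/seteqP; split.
  by rewrite /U big_ord_recr; exact: approximableU (mU n) (mB n) IH (aB n).
have mBU : measurable (\bigcup_n B n) by exact: bigcupT_measurable.
have [n hn] : exists n, (m (\bigcup_n B n `\` U n) <= (e / 2)%:E)%E.
  pose F n := \bigcup_n B n `\` U n.
  have mF n : measurable (F n) by exact: measurableD.
  have F0 : \bigcap_n F n = set0.
    rewrite -subset0 => x Fx; have [[k _ Bkx] _] := Fx 0%N I.
    have [_] := Fx k.+1 I; apply.
    by rewrite /U -bigcup_mkord; exists k => //=.
  have cF : m \o F @ \oo --> m (\bigcap_n F n).
    apply: nonincreasing_cvg_mu => //.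
    - by rewrite ltey_eq fin_num_measure.
    - by rewrite F0.
    - move=> i j ij; apply/subsetPset; apply: setDS.
      exact: subset_bigsetU.
  rewrite F0 measure0 in cF.
  have /fine_cvgP[_ /cvgrPdist_le/(_ _ e2)[n _ /(_ n (leqnn n)) /= hn]] := cF.
  exists n; rewrite -(fineK (fin_num_measure m _ (mF n))) lee_fin.
  by apply: le_trans hn; rewrite sub0r normrN ler_norm.
have [N [D hD]] := aU n _ e2; exists N, D.
have e_split : (e%:E = (e / 2)%:E + (e / 2)%:E)%E by rewrite -EFinD -splitr.
rewrite e_split; apply: le_trans (leeD hn hD).
apply: le_trans (measureU2 m (measurableD mBU (mU n)) (@msym (U n) N D (mU n))).
apply: le_measure; rewrite ?inE.
- exact: msym.
- by apply: measurableU; [exact: measurableD|exact: msym].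
- move=> x [[Bx nDx]|[Dx nBx]].
    by have [Ux|nUx] := pselect (U n x); [right; left|left].
  right; right; split => //; apply: contra_not nBx.
  by rewrite /U -bigcup_mkord => -[k _ ?]; exists k.
Qed.

(** The sets with both properties form a sigma-algebra; measurability is carried along because the
    step for unions relies on it. *)
Lemma approximable_generated (G : set (set T)) : (forall B, G B -> measurable B /\ approximable B) ->
  forall B, <<s G >> B -> measurable B /\ approximable B.
Proof.
move=> hG; apply: smallest_sub; last exact: hG.
split.
- split=> //; rewrite (_ : set0 = cylinder 0 (fun=> false)); first exact: approximable_cylinder.
  by apply/seteqP; split.
- move=> B [mB aB]; rewrite setTD; split; [exact: measurableC|exact: approximableC].
- move=> B hB; split; first by apply: bigcupT_measurable => n; have [] := hB n.
  by apply: approximable_bigcup => n; have [] := hB n.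
Qed.

End Approximable.

(** * Invariant measures of maximal entropy *)

Lemma open_borel (X : ptopologicalType) (O : set X) : open O -> measurable (O : set (borel X)).
Proof. exact: sub_sigma_algebra. Qed.

Lemma closed_borel (X : ptopologicalType) (C : set X) : closed C -> measurable (C : set (borel X)).
Proof.
by move=> cC; rewrite -[C]setCK; apply: measurableC; apply: open_borel; rewrite openC.
Qed.

Lemma continuous_borel (X Y : ptopologicalType) (f : X -> Y) : continuous f ->
  measurable_fun setT (f : borel X -> borel Y).
Proof.
move=> cf _ B mB; rewrite setTI.
suff : <<s @open Y >> `<=` [set B | measurable (f @^-1` B : set (borel X))] by apply.
apply: smallest_sub => [|O oO]; last first.
  by apply: open_borel; move/continuousP: cf; apply.
split=> [|C /= mC|F /= mF]; first by rewrite /= preimage_set0.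
- by rewrite setTD preimage_setC; exact: measurableC.
- by rewrite preimage_bigcup; exact: bigcupT_measurable.
Qed.

Section MaximalEntropy.
Variables (R : realType) (d : nat) (hd : (2 <= d)%N).
Variables (A : circle R -> circle R) (psi : subshift hd -> circle R).
Hypotheses (hA : is_bowen_series_map d A) (hpsi : is_cannon_thurston_map A psi).
Variable nu : probability (borel (circle R)) R.
Hypothesis hnu : is_measure_of_maximal_entropy A nu.
Implicit Types (s t : letter d).

Local Notation f := (A : borel (circle R) -> borel (circle R)).
Local Notation y := (label hpsi : borel (circle R) -> letter d).

Lemma bowen_series_measurable : measurable_fun setT f.
Proof. by apply: continuous_borel; exact: bowen_series_continuous hpsi. Qed.

Lemma bowen_series_invariant B : measurable B -> nu (f @^-1` B) = nu B.
Proof. by case: hnu => h _; exact: h. Qed.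

Lemma finitely_measurable_label : finitely_measurable y.
Proof.
move=> s; rewrite (_ : _ @^-1` _ = half_arc s); last first.
  by apply/seteqP; split=> x /=; move/(labelP hpsi).
by apply: measurableD; apply: closed_borel; exact: closed_circle_arc hpsi _.
Qed.

Let mf := bowen_series_measurable.
Let my := finitely_measurable_label.

Lemma word_itinerary n (x : circle R) i : (i < n)%N ->
  nth (Ordinal hd, true) (word f y n x) i = digit (itinerary hA hpsi x) i.
Proof. by move=> ni; rewrite nth_word. Qed.

(** An open set is the union of the cylinders that it contains: each point is the image of its
    itinerary, and [psi] is continuous, so a long enough prefix keeps the image in the set. *)
Lemma approximable_borel (B : set (borel (circle R))) : measurable B -> approximable nu f y B.
Proof.
move=> mB; suff : measurable B /\ approximable nu f y B by case.
move: B mB; apply: (approximable_generated mf my) => O oO.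
split; first exact: open_borel.
pose D n (w : seq (letter d)) := `[< forall z, word f y n z = w :> seq _ -> O z >].
have -> : O = \bigcup_n cylinder f y n (D n).
  apply/seteqP; split=> x; last by move=> [n _ /asboolP]; apply.
  move=> Ox.
  have : nbhs (itinerary hA hpsi x) (psi @^-1` O).
    apply: (psi_continuous hpsi); apply: open_nbhs_nbhs; split => //.
    by rewrite psi_itinerary.
  move=> /nbhs_digits[n hn]; exists n => //; apply/asboolP => z zx.
  rewrite -(psi_itinerary hA hpsi z); apply: hn => i ni.
  by rewrite -!(word_itinerary _ ni) zx.
apply: approximable_bigcup => // n; first exact: measurable_cylinder.
exact: approximable_cylinder.
Qed.

Lemma measure_entropy_ge : ((ln (2 * d - 1)%N%:R)%:E <= measure_entropy nu f)%E.
Proof. by case: hnu => _ ->; exact: topological_entropy_ge hA hpsi. Qed.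

(** Only the first label of the future restricts the letter in front of it; the length [n.+1]
    ensures that there is one. *)
Let allowed n (w : n.+1.-tuple (letter d)) : pred (letter d) := fun s => follows s (thead w).

Lemma law_word_cons n s (w : n.-tuple (letter d)) :
  law nu (word f y n.+1) (cons_tuple s w) = law nu (transition f y n) (s, w).
Proof.
rewrite /law; congr (fine (nu _)); apply/seteqP; split=> x /=; rewrite wordS /transition.
  by move=> /(congr1 val) /= [-> e]; congr (_, _); apply: val_inj.
by move=> [-> <-].
Qed.

(** By invariance the mass of [w] is that of its preimage, which splits into the extensions by a
    letter on the left. The [2 * d - 1] allowed ones have equal mass by maximality of the entropy,
    the others have mass 0. *)
Lemma law_transition_allowed n s (w : n.+1.-tuple (letter d)) : follows s (thead w) ->
  law nu (transition f y n.+1) (s, w) = law nu (word f y n.+1) w / (2 * d - 1)%N%:R.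
Proof.
move=> sw; pose N := (2 * d - 1)%N.
have N0 : (0 < N)%N by rewrite /N; lia.
have card_allowed u : #|@allowed n u| = N.
  rewrite /N -(sum_follows (thead u)) -sum1_card [LHS]big_mkcond; apply: eq_bigr => t _.
  by rewrite /follows inv_letter_sym unfold_in /allowed /follows; case: (_ != _).
have allowedP x : allowed (word f y n.+1 (f x)) (y x).
  rewrite /allowed /follows /thead (tnth_nth (Ordinal hd, true)) nth_word //=.
  exact: label_admissible.
have trans0 t : ~~ follows t (thead w) -> law nu (transition f y n.+1) (t, w) = 0.
  move=> tw; apply/eqP; rewrite eq_le law_ge0 andbT leNgt; apply/negP => /law_gt0[x [yx xw]].
  by move: (allowedP x); rewrite xw yx /allowed (negPf tw).
have -> : law nu (word f y n.+1) w = \sum_t law nu (transition f y n.+1) (t, w).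
  rewrite -(law_step bowen_series_invariant (finitely_measurable_word mf my (N := n.+1))).
  rewrite -[_ \o f]/(snd \o transition f y n.+1) law_comp; last exact: finitely_measurable_transition.
  rewrite (reindex_onto (fun t => (t, w)) fst) /=; first by apply: eq_bigl => t; rewrite !eqxx.
  by move=> [t u] /= /eqP ->.
rewrite (bigID (fun t => follows t (thead w))) /= [X in _ + X]big1 ?addr0; last by move=> t; exact: trans0.
rewrite (eq_bigr (fun=> law nu (transition f y n.+1) (s, w))); last first.
  move=> t tw; apply: (law_transition_eq mf bowen_series_invariant my approximable_borel N0 card_allowed allowedP) => //.
  exact: measure_entropy_ge.
rewrite sumr_const (_ : #|_| = N); last by rewrite -(card_allowed w).
by rewrite -[_ *+ N]mulr_natr mulfK // pnatr_eq0; lia.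
Qed.

(** Every letter [r] other than the inverse of [t] is preceded by [t] with a share [1 / N] of its
    mass, which gives the identity [key]. Written for [s] and for its inverse, it forces equal
    masses, since [N] exceeds 1, and then their value. *)
Lemma law_label s : law nu y s = (2 * d)%N%:R^-1.
Proof.
have my1 := finitely_measurable_word mf my (N := 1).
have law1 t : law nu (word f y 1) [tuple t] = law nu y t.
  rewrite /law; congr (fine (nu _)); apply/seteqP; split=> x /=.
    by move=> /(congr1 val) [].
  by move=> <-; apply: val_inj.
pose N : R := (2 * d - 1)%N%:R.
have hN : N = 2 * d%:R - 1 by rewrite /N natrB ?natrM //; lia.
have d2 : 2 <= d%:R :> R by rewrite (ler_nat _ 2).
have key t : N * law nu y t = 1 - law nu y (inv_letter t).
  have -> : law nu y t = \sum_(w : 1.-tuple (letter d)) law nu (transition f y 1) (t, w).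
    rewrite -[y]/(fst \o transition f y 1) law_comp; last exact: finitely_measurable_transition.
    rewrite (reindex_onto (fun w => (t, w)) snd) /=; first by apply: eq_bigl => w; rewrite !eqxx.
    by move=> [u w] /= /eqP ->.
  rewrite (reindex (fun r : letter d => [tuple r])); last first.
    exists (fun w : 1.-tuple (letter d) => thead w) => [r _|w _] //=.
    by apply: val_inj; case: w => [[|a [|b l]] i] //=; rewrite /thead (tnth_nth a).
  rewrite -(law_sum nu my) [in RHS](bigD1 (inv_letter t)) //= addrC addrK.
  rewrite (bigD1 (inv_letter t)) //= [X in _ * (X + _)](_ : _ = 0) ?add0r; last first.
    apply/eqP; rewrite eq_le law_ge0 andbT leNgt; apply/negP => /law_gt0[x [yx yfx]].
    by have := label_admissible hA hpsi x; rewrite yx yfx eqxx.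
  rewrite mulr_sumr; apply: eq_bigr => r rt; rewrite law_transition_allowed //.
  by rewrite law1 mulrC divfK // -/N hN gt_eqF //; lra.
have k1 := key s; have := key (inv_letter s); rewrite inv_letterK => k2.
have e : law nu y s = law nu y (inv_letter s).
  apply/eqP; rewrite -subr_eq0.
  have : (N - 1) * (law nu y s - law nu y (inv_letter s)) == 0.
    by apply/eqP; rewrite mulrBl mul1r [N * _]mulrBr k1 k2; ring.
  by rewrite mulf_eq0 hN => /orP[/eqP h|//]; exfalso; lra.
rewrite -e hN in k1.
rewrite natrM; apply: (mulfI (x := 2 * d%:R)); first by rewrite gt_eqF //; lra.
rewrite divff; first lra.
by rewrite gt_eqF //; lra.
Qed.

Lemma law_word n (w : n.+1.-tuple (letter d)) : reduced w ->
  law nu (word f y n.+1) w = ((2 * d)%N%:R * (2 * d - 1)%N%:R ^+ n)^-1.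
Proof.
elim: n w => [|n IH] w.
  case/tupleP: w => s w _; rewrite expr0 mulr1 -(law_label s) /law.
  congr (fine (nu _)); apply/seteqP; split=> x /=.
    by move=> /(congr1 val) [].
  by move=> <-; apply: val_inj; rewrite /= (tuple0 w).
case/tupleP: w => s w; rewrite /reduced /= => sw.
have follows_sw : follows s (thead w) by case/tupleP: w sw => t w /= /andP[].
have red_w : reduced w by exact: path_sorted sw.
rewrite law_word_cons law_transition_allowed // IH // exprSr mulrA [RHS]invfM.
reflexivity.
Qed.

End MaximalEntropy.

(** * The Patterson-Sullivan measure *)

Lemma prefix_onth (T : eqType) (u v : seq T) :
  prefix u v <-> forall i, (i < size u)%N -> onth v i = onth u i.
Proof.
split=> [/prefixP[w ->] i iu|]; first by rewrite onth_cat iu.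
elim: u v => [|a u IH] [|b v] //= h; first by have := h 0%N isT.
have [->] : Some b = Some a by exact: (h 0%N isT).
by rewrite eqxx; apply: IH => i iu; exact: (h i.+1).
Qed.

Lemma uniq_flatten_sizes (T : eqType) (E : nat -> seq (seq T)) (r : seq nat) :
  uniq r -> (forall l, uniq (E l)) -> (forall l x, x \in E l -> size x = l) ->
  uniq (flatten [seq E l | l <- r]).
Proof.
move=> + uE sE; elim: r => //= l r IH /andP[lr /IH u].
rewrite cat_uniq uE u andbT /=; apply/hasPn => x /flatten_mapP[k kr xk].
by apply: contraNN lr => /sE <-; rewrite (sE _ _ xk).
Qed.

(** * Weighted sums over balls of the Cayley tree *)

Section BallSums.
Variables (R : realType) (d : nat).
Implicit Types (s t : letter d) (u v : seq (letter d)).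

Lemma sum_ball (F : seq (letter d) -> R) n :
  \sum_(g \in [set g : free_word d | (word_length g <= n)%N]) F (val g) =
  \sum_(l < n.+1) \sum_(v : l.-tuple (letter d) | reduced v) F v.
Proof.
pose E l := map val (enum {: l.-tuple (letter d)}).
(* All words of length at most [n], reduced or not; the partial map [insub] below discards those
   that are not reduced. *)
pose L := flatten [seq E l | l <- iota 0 n.+1].
have memE l v : (v \in E l) = (size v == l).
  apply/mapP/eqP => [[w _ ->]|vl]; first by rewrite size_tuple.
  by exists (tcast vl (in_tuple v)); [rewrite mem_enum|exact: esym (val_tcast vl (in_tuple v))].
have uL : uniq L.
  apply: uniq_flatten_sizes => [|l|l v]; first exact: iota_uniq.
    by rewrite map_inj_uniq ?enum_uniq //; exact: val_inj.
  by rewrite memE => /eqP.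
pose r : seq (free_word d) := pmap insub L.
have -> : [set g : free_word d | (word_length g <= n)%N] = [set` r].
  apply/seteqP; split=> g /=; rewrite mem_pmap_sub.
    move=> gn; apply/flatten_mapP; exists (size (val g)); last by rewrite memE.
    by rewrite mem_iota.
  by move=> /flatten_mapP[l]; rewrite mem_iota memE add0n ltnS /word_length /= => ln /eqP ->.
rewrite -fsbig_seq; last exact: pmap_sub_uniq.
rewrite big_pmap (eq_bigr (fun v => if reduced v then F v else 0)); last first.
  by move=> v _; case: insubP => [g gv <-|/negPf ->] //=; rewrite (valP g).
rewrite big_flatten big_map -[iota 0 n.+1]/(index_iota 0 n.+1) big_mkord.
by apply: eq_bigr => l _; rewrite big_map big_enum -big_mkcond.
Qed.

Lemma count_prefix t u l : (size u <= l)%N ->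
  \sum_(v : l.-tuple (letter d)) (path (@follows d) t v && prefix u v)%:R =
  (path (@follows d) t u)%:R * (2 * d - 1)%N%:R ^+ (l - size u) :> R.
Proof.
elim: u t l => [|s u IH] t l.
  rewrite subn0 mul1r -natrX -(count_paths t l) natr_sum => _.
  by apply: eq_bigr => v _; rewrite prefix0s andbT.
case: l => // l ul; rewrite big_cons_tuple (bigD1 s) //= [X in _ + X]big1 ?addr0.
  rewrite subSS; case: (follows t s); last by rewrite mul0r big1.
  by rewrite /= -IH //; apply: eq_bigr => v _; rewrite eqxx.
move=> r rs; apply: big1 => v _.
by rewrite [s == r]eq_sym (negPf rs) andbF.
Qed.

Lemma count_reduced_prefix s u l : (size u <= l)%N -> reduced (s :: u) ->
  \sum_(v : l.+1.-tuple (letter d) | reduced v) (prefix (s :: u) v)%:R =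
  (2 * d - 1)%N%:R ^+ (l - size u) :> R.
Proof.
move=> ul su; rewrite big_mkcond big_cons_tuple (bigD1 s) //= [X in _ + X]big1 ?addr0.
  have pu : path (@follows d) s u := su.
  have := count_prefix s ul; rewrite pu mul1r => <-; apply: eq_bigr => v _.
  by rewrite eqxx /reduced /=; case: path.
move=> r rs; apply: big1 => v _.
by rewrite [s == r]eq_sym (negPf rs) if_same.
Qed.

Lemma count_reduced l :
  \sum_(v : l.+1.-tuple (letter d) | reduced v) 1 =
  (2 * d)%N%:R * (2 * d - 1)%N%:R ^+ l :> R.
Proof.
rewrite big_mkcond big_cons_tuple (eq_bigr (fun=> (2 * d - 1)%N%:R ^+ l)).
  by rewrite sumr_const card_letter -[LHS]mulr_natl.
move=> s _; have := count_prefix s (u := [::]) (leq0n l).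
rewrite subn0 mul1r => <-; apply: eq_bigr => v _.
by rewrite /reduced /=; case: path => //=; rewrite prefix0s.
Qed.

Hypothesis hd : (2 <= d)%N.
Let m : R := (2 * d - 1)%N%:R.
Let m0 : m != 0. Proof. by rewrite /m pnatr_eq0; lia. Qed.

(** The identity contributes 1, and each sphere of positive radius has the same weight: its size
    grows as fast as the weight of its elements decays. *)
Lemma ball_weightE n : ball_weight R d n = 1 + n%:R * ((2 * d)%N%:R / m).
Proof.
rewrite /ball_weight (sum_ball (fun v => m ^- size v)) big_ord_recl /=.
congr (_ + _).
  rewrite (big_pred1 [tuple]) /= ?expr0 ?invr1 // => v.
  by rewrite (tuple0 v); apply/esym/eqP.
rewrite (eq_bigr (fun=> (2 * d)%N%:R / m)) => [|l _].
  by rewrite sumr_const card_ord [RHS]mulr_natl.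
rewrite (eq_bigr (fun=> m ^- l.+1 * 1)) => [|v _]; last by rewrite size_tuple mulr1.
rewrite -mulr_sumr count_reduced -/m mulrCA; congr (_ * _).
by rewrite exprS invfM -mulrA mulVf ?mulr1 // expf_neq0.
Qed.

(** Each of the [n - size u] spheres of radius greater than [size u] again contributes the same
    amount. *)
Lemma ball_prefix_sum n s u : reduced (s :: u) -> (size u < n)%N ->
  \sum_(g \in [set g : free_word d | (word_length g <= n)%N])
    (m ^- word_length g * (prefix (s :: u) (val g))%:R) =
  (n - size u)%N%:R * m ^- (size u).+1.
Proof.
move=> su un; rewrite (sum_ball (fun v => m ^- size v * (prefix (s :: u) v)%:R)).
rewrite big_ord_recl big1 ?add0r => [|v _]; last by rewrite (tuple0 v) mulr0.
rewrite (eq_bigr (fun l : 'I_n => if (size u <= l)%N then m ^- (size u).+1 else 0)).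
  rewrite -big_mkcond /= -(big_geq_mkord _ _ xpredT (fun=> m ^- (size u).+1)).
  by rewrite sumr_const_nat [RHS]mulr_natl.
move=> l _; rewrite (eq_bigr (fun v : l.+1.-tuple _ => m ^- l.+1 * (prefix (s :: u) v)%:R)); last first.
  by move=> v _; rewrite size_tuple.
rewrite -mulr_sumr; case: leqP => ul.
  rewrite count_reduced_prefix // -/m.
  have -> : m ^+ l.+1 = m ^+ (l - size u) * m ^+ (size u).+1 by rewrite -exprD addnS subnK.
  by rewrite invfM mulrC mulrA divff ?mul1r // expf_neq0.
rewrite big1 ?mulr0 // => v _; rewrite (_ : prefix _ _ = false) //.
by apply/negP => /prefixP[w /(congr1 size)]; rewrite size_cat size_tuple /=; lia.
Qed.

End BallSums.

Section PattersonSullivanMeasure.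
Variables (R : realType) (d : nat) (hd : (2 <= d)%N).
Variable mu : probability (borel (subshift hd)) R.
Hypothesis hmu : is_patterson_sullivan mu.
Implicit Types (s t : letter d) (u v : seq (letter d)).

(** The vertices and ends beyond [u]; a finite word shorter than [u] is excluded by its value
    [None]. *)
Definition shadow u : set (tree_completion d) :=
  [set z | forall i, (i < size u)%N -> set_val z i = onth u i].

Definition shadow_indic u (z : tree_completion d) : R := `[< shadow u z >]%:R.

(** Finitely many coordinates decide membership, so the indicator is locally constant and may serve
    as test function for the weak limit. *)
Lemma shadow_indic_continuous u : continuous (shadow_indic u).
Proof.
move=> z; apply: (near_cst_continuous (shadow_indic u z)).
have : nbhs z [set z' : tree_completion d |
    forall i, (i < size u)%N -> set_val z' i = set_val z i].
  apply: open_nbhs_nbhs; split; last by move=> i.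
  exact: (@prefix_open _ (@reduced_path d)).
apply: filterS => z' zz'; rewrite /shadow_indic; congr ((nat_of_bool _)%:R).
by apply: asbool_equiv_eq; split=> h i iu; [rewrite -zz' // h|rewrite zz' // h].
Qed.

Lemma shadow_indic_vertex u (g : free_word d) : shadow_indic u (vertex g) = (prefix u (val g))%:R.
Proof.
rewrite /shadow_indic; congr ((nat_of_bool _)%:R).
by apply/asboolP/idP => [h|/prefix_onth//]; apply/prefix_onth => i iu; exact: h.
Qed.

Lemma ball_average_shadow s u : reduced (s :: u) ->
  ball_average n (shadow_indic (s :: u)) @[n --> \oo] -->
    (((2 * d)%N%:R * (2 * d - 1)%N%:R ^+ size u)^-1 : R).
Proof.
move=> su; pose m : R := (2 * d - 1)%N%:R; set l := _^-1.
have m0 : 0 < m by rewrite /m ltr0n; lia.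
have d0 : 0 < (2 * d)%N%:R :> R by rewrite ltr0n; lia.
pose b := (2 * d)%N%:R / m; have b0 : 0 < b by rewrite divr_gt0.
have lE : l * b = m ^- (size u).+1.
  by rewrite /l /b invfM mulrACA mulVf ?gt_eqF // mul1r exprSr invfM.
(* Here [b] is the weight of a sphere and [l * b] that of its part in the shadow. The constant is
   the defect in [(n - size u) * (l * b) = l * (1 + n * b) - C], so the average differs from [l] by
   [C / (1 + n * b)]. *)
pose C := (size u)%:R * (l * b) + l.
apply/cvgrPdist_le => e e0.
exists (Num.truncn (`|C| / (e * b)) + (size u).+1)%N => // n /= hn.
have un : (size u < n)%N by apply: leq_trans hn; rewrite leq_addl.
have n0 : 0 < n%:R :> R by rewrite ltr0n; apply: leq_trans un.
have bn : 0 < 1 + n%:R * b by rewrite addr_gt0 // mulr_gt0.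
have -> : ball_average n (shadow_indic (s :: u)) = l - C / (1 + n%:R * b).
  rewrite /ball_average ball_weightE // -/m -/b.
  have -> : \sum_(g \in [set g : free_word d | (word_length g <= n)%N])
      (m ^- word_length g * shadow_indic (s :: u) (vertex g)) =
      (n - size u)%N%:R * m ^- (size u).+1.
    by rewrite -(ball_prefix_sum R hd su un); apply: eq_fsbigr => g _; rewrite shadow_indic_vertex.
  rewrite natrB ?(ltnW un) // -lE /C.
  apply: (mulIf (lt0r_neq0 bn)); rewrite divfK ?gt_eqF // [RHS]mulrBl divfK ?gt_eqF //.
  by ring.
rewrite opprB addrC subrK normrM normfV (gtr0_norm bn) ler_pdivrMr // mulrDr mulr1.
have : `|C| / (e * b) <= n%:R.
  apply: le_trans (ltW (truncnS_gt _)) _; rewrite ler_nat.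
  by apply: leq_trans hn; rewrite addnS ltnS leq_addr.
rewrite ler_pdivrMr ?(mulr_gt0 e0 b0) // => h; apply: (le_trans h).
by rewrite [n%:R * (e * b)]mulrCA lerDr ltW.
Qed.

(** The identification with the boundary inverts every letter, so the cylinder of [w] corresponds to
    the shadow of the letterwise inverse of [w], which is again reduced. Its indicator is
    continuous, so its integral is the limit of the ball averages. *)
Lemma patterson_sullivan_cylinder n (w : n.+1.-tuple (letter d)) : reduced w ->
  fine (mu [set x | forall i : 'I_n.+1, digit x i = tnth w i]) =
  ((2 * d)%N%:R * (2 * d - 1)%N%:R ^+ n)^-1.
Proof.
case/tupleP: w => s w sw.
have inv_path t v : path (@follows d) (inv_letter t) (map (@inv_letter d) v) = path (@follows d) t v.
  elim: v t => //= a v IH t; rewrite IH; congr (_ && _).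
  by rewrite /follows (inj_eq (@inv_letter_inj d)).
have su : reduced (inv_letter s :: map (@inv_letter d) w).
  by rewrite /reduced /=; rewrite -[path _ _ _]/(path (@follows d) _ _) inv_path.
have := ball_average_shadow su; rewrite size_map size_tuple => h.
have := hmu (@shadow_indic_continuous (inv_letter s :: map (@inv_letter d) w)).
move=> /(cvg_unique (@norm_hausdorff _ R) h) ->.
set S := [set x | _].
have mS : measurable (S : set (borel (subshift hd))).
  rewrite /S (_ : [set x | _] = \bigcap_(i in [set: 'I_n.+1])
    [set x : subshift hd | digit x i = tnth (cons_tuple s w) i]).
    apply: fin_bigcap_measurable => // i _; apply: open_borel.
    exact: (digit_open hd i [set tnth (cons_tuple s w) i]).
  by apply/seteqP; split=> x /= h' i; [move=> _|]; exact: h'.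
rewrite /Rintegral; congr fine.
rewrite -[in LHS](setIT S) -(integral_indic mu measurableT mS).
apply: eq_integral => x _; congr EFin.
rewrite indicE /shadow_indic; congr ((nat_of_bool _)%:R).
apply/idP/asboolP => [|sh].
  rewrite inE => xS i; rewrite /= size_map size_tuple => ni.
  rewrite -[LHS]/(Some (inv_letter (digit x i))).
  have -> : digit x i = nth s (s :: w) i.
    by have := xS (Ordinal ni); rewrite (tnth_nth s).
  rewrite -[_ :: _ in RHS]/(map (@inv_letter d) (s :: w)) onth_map.
  by rewrite onthE (nth_map s) //= size_tuple.
rewrite inE => i; have ni := ltn_ord i.
have ni' : (i < size (inv_letter s :: map (@inv_letter d) w))%N.
  by rewrite /= size_map size_tuple.
have := sh i ni'.
rewrite -[LHS]/(Some (inv_letter (digit x i))).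
rewrite -[_ :: _ in X in X -> _]/(map (@inv_letter d) (s :: w)) onth_map.
rewrite onthE (nth_map s) /= ?size_tuple // => /Some_inj /inv_letter_inj ->.
by rewrite (tnth_nth s).
Qed.

End PattersonSullivanMeasure.

(** * Cylinders generate the Borel sets of the subshift *)

Section SubshiftBorel.
Variables (d : nat) (hd : (2 <= d)%N).

Let base : letter d := (Ordinal hd, true).

Definition digits_cylinder (w : seq (letter d)) : set (borel (subshift hd)) :=
  [set x | forall i, (i < size w)%N -> digit x i = nth base w i].

(** The empty set is included so that the family is stable under intersection. *)
Definition digits_cylinders : set (set (borel (subshift hd))) :=
  [set C | C = set0 \/ exists w, C = digits_cylinder w].

Lemma digits_cylinder_open w : open (digits_cylinder w : set (subshift hd)).
Proof.
rewrite (_ : digits_cylinder w = \bigcap_(i in [set` iota 0 (size w)])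
    [set x : subshift hd | digit x i = nth base w i]); last first.
  apply/seteqP; split=> x /= h i; first by move=> /=; rewrite mem_iota => /h.
  by move=> iw; apply: h; rewrite /= mem_iota.
rewrite bigcap_seq; apply: (big_ind (fun O : set (subshift hd) => open O)).
- exact: openT.
- exact: openI.
- move=> i _; exact: (digit_open hd i [set nth base w i]).
Qed.

(** Two cylinders are nested or disjoint, according to whether one word is a prefix of the other. *)
Lemma digits_cylinders_setI : setI_closed digits_cylinders.
Proof.
have sub v w : (size v <= size w)%N ->
    digits_cylinders (digits_cylinder v `&` digits_cylinder w).
  move=> vw; have [/eqP e|/eqP ne] := boolP (take (size v) w == v).
    right; exists w; apply: setIidr => x xw i iv.
    by rewrite xw ?(leq_trans iv) // -e nth_take.
  left; rewrite -subset0 => x [xv xw]; apply: ne.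
  have sz : size (take (size v) w) = size v by rewrite size_takel.
  apply: (@eq_from_nth _ base) => // i; rewrite sz => iv.
  by rewrite nth_take // -xv // xw // (leq_trans iv).
move=> B C [->|[v ->]]; first by rewrite set0I; left.
move=> [->|[w ->]]; first by rewrite setI0; left.
have [vw|/ltnW wv] := leqP (size v) (size w); first exact: sub.
by rewrite setIC; exact: sub.
Qed.

(** There are countably many cylinders, and an open set is the union of those that it contains. *)
Lemma borel_subshiftE : @measurable _ (borel (subshift hd)) = <<s digits_cylinders >>.
Proof.
apply/seteqP; split.
  apply: smallest_sub; first exact: smallest_sigma_algebra.
  move=> O oO.
  pose c (n : nat) (w : n.-tuple (letter d)) : set (borel (subshift hd)) :=
    if `[< digits_cylinder w `<=` O >] then digits_cylinder w else set0.
  rewrite (_ : O = \bigcup_n \bigcup_(w in [set` enum {: n.-tuple (letter d)}]) c n w).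
    apply: sigma_algebra_bigcup => n; rewrite bigcup_seq.
    apply: (big_ind (fun B => <<s digits_cylinders >> B)).
    - exact: sigma_algebra0.
    - by move=> B C; exact: (@measurableU _ (g_sigma_algebraType digits_cylinders)).
    - move=> w _; apply: sub_sigma_algebra; rewrite /c.
      by case: ifP => _; [right; exists w|left].
  apply/seteqP; split=> x.
    move=> Ox; have [n nO] := nbhs_digits (open_nbhs_nbhs (conj oO Ox)).
    exists n => //; exists [tuple @digit d hd x i | i < n]; first by rewrite /= mem_enum.
    rewrite /c; case: asboolP => [_ i|].
      by rewrite size_tuple => ni; rewrite -(tnth_nth base _ (Ordinal ni)) tnth_mktuple.
    case=> z zx; apply: nO => i ni.
    by rewrite zx ?size_tuple // -(tnth_nth base _ (Ordinal ni)) tnth_mktuple.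
  by move=> [n _ [w _]]; rewrite /c; case: asboolP => // h /h.
apply: smallest_sub; first exact: sigma_algebra_measurable.
move=> B [->|[w ->]]; first exact: measurable0.
by apply: open_borel; exact: digits_cylinder_open.
Qed.

End SubshiftBorel.

(** * Identification of the two measures *)

(** Dynkin's theorem reduces the claim to cylinders, where both masses are known for reduced words
    and the other nonempty words have empty cylinders. Measurability is part of the induction, as
    complements and unions of preimages need it. *)
Lemma itinerary_distribution (R : realType) (d : nat) (hd : (2 <= d)%N)
    (A : circle R -> circle R) (psi : subshift hd -> circle R)
    (hA : is_bowen_series_map d A) (hpsi : is_cannon_thurston_map A psi)
    (nu : probability (borel (circle R)) R) (hnu : is_measure_of_maximal_entropy A nu)
    (mu : probability (borel (subshift hd)) R) (hmu : is_patterson_sullivan mu)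
    (B : set (borel (subshift hd))) : measurable B ->
  measurable (itinerary hA hpsi @^-1` B : set (borel (circle R))) /\
  mu B = nu (itinerary hA hpsi @^-1` B).
Proof.
pose it : borel (circle R) -> borel (subshift hd) := itinerary hA hpsi.
rewrite borel_subshiftE; move: B; apply: (@dynkin_induction _ (borel (subshift hd)) (@digits_cylinders d hd)
  (fun B => measurable (it @^-1` B) /\ mu B = nu (it @^-1` B))).
- exact: borel_subshiftE.
- exact: digits_cylinders_setI.
- by rewrite preimage_setT !probability_setT.
- move=> _ [->|[w ->]]; first by rewrite preimage_set0 !measure0.
  have itE : it @^-1` @digits_cylinder d hd w =
      word (A : borel (circle R) -> borel (circle R)) (label hpsi : borel (circle R) -> letter d) (size w) @^-1` [set in_tuple w].
    apply/seteqP; split=> z /= h.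
      apply: eq_from_tnth => i; rewrite !(tnth_nth (Ordinal hd, true)).
      by rewrite (word_itinerary hA) ?size_tuple //; exact: h.
    by move=> i iw; have := word_itinerary hA hpsi z iw; rewrite h => <-.
  have mit : measurable (it @^-1` @digits_cylinder d hd w).
    rewrite itE; apply: finitely_measurable_word.
      exact: bowen_series_measurable hpsi.
    exact: finitely_measurable_label.
  split => //.
  have mC : measurable (@digits_cylinder d hd w).
    by apply: open_borel; exact: digits_cylinder_open.
  rewrite -[LHS]fineK ?fin_num_measure // -[RHS]fineK ?fin_num_measure //; congr EFin.
  (* The empty word is separate: its cylinder is the whole space, and the formula for the mass
     starts at length one. *)
  case: w itE mit mC => [|s w] itE mit mC.
    by rewrite (_ : @digits_cylinder d hd [::] = setT) ?preimage_setT ?probability_setT //; apply/seteqP.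
  have [sw|nsw] := boolP (reduced (s :: w)).
    rewrite [in RHS]itE -/(law _ _ _) (law_word hA hpsi hnu (n := size w)) //.
    rewrite -(patterson_sullivan_cylinder hmu (w := in_tuple (s :: w))) //.
    congr (fine (mu _)); apply/seteqP; split=> x h i.
      by rewrite (tnth_nth (Ordinal hd, true)); exact: h.
    by move=> iw; have := h (Ordinal iw); rewrite (tnth_nth (Ordinal hd, true)).
  have C0 : @digits_cylinder d hd (s :: w) = set0.
    rewrite -subset0 => x h; move/negP: nsw; apply.
    rewrite /reduced; apply/(sortedP (Ordinal hd, true)) => i iw.
    by rewrite -!h ?(ltnW iw) //; exact: digit_admissible.
  by rewrite C0 preimage_set0 !measure0.
- move=> B mB [mit e]; rewrite preimage_setC; split; first exact: measurableC.
  by rewrite !probability_setC // e.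
- move=> F mF tF hF; rewrite preimage_bigcup; split.
    by apply: bigcupT_measurable => n; have [] := hF n.
  rewrite !measure_bigcup //.
  + by apply: eq_eseriesr => n _; exact: (hF n).2.
  + by move=> n _; have [] := hF n.
  + by move=> i j _ _ [z [Fi Fj]]; apply: tF => //; exists (it z).
Qed.

Theorem proposition6p7 (R : realType) (d : nat) (hd : (2 <= d)%N)
    (A : circle R -> circle R) (hA : is_bowen_series_map d A)
    (nu : probability (borel (circle R)) R)
    (hnu : is_measure_of_maximal_entropy A nu)
    (mu : probability (borel (subshift hd)) R)
    (hmu : is_patterson_sullivan mu)
    (psi : subshift hd -> circle R) (hpsi : is_cannon_thurston_map A psi) :
  forall B : set (borel (circle R)), measurable B ->
    nu B = pushforward mu (psi : borel (subshift hd) -> borel (circle R)) B.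
Proof.
move=> B mB; rewrite /pushforward.
have mpsiB : measurable (psi @^-1` B : set (borel (subshift hd))).
  by have := continuous_borel (psi_continuous hpsi) measurableT mB; rewrite setTI.
have [_ ->] := itinerary_distribution hA hpsi hnu hmu mpsiB.
(* As the itinerary is a section of [psi], pulling [B] back along [psi] and then along the itinerary
   returns [B]. *)
congr (nu _); apply/seteqP; split=> z /=; by rewrite psi_itinerary.
Qed.
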